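(* Let $G$ be an amenable locally compact group. If for some weight $w$ on $G$ and some $p$ with $1<p<\infty$ the space $\mathcal{L}_p^w(G)$ is an algebra with respect to convolution, then $G$ is $\sigma$-compact.
   Context: $G$ is a locally compact group with left Haar measure $\mu$ ($dt$). A weight on $G$ is a measurable function $w:G\to(0,\infty)$. For $1\leqslant p<\infty$, $$\mathcal{L}_p^w(G)=\Big\{f:G\to\mathbb{C}\text{ measurable}\ :\ \int_G|fw|^p<\infty\Big\}$$ (functions equal almost everywhere being identified). Convolution is $(f*g)(s)=\int_G f(t)g(t^{-1}s)\,dt$. That $\mathcal{L}_p^w(G)$ is an algebra means that for all $f,g\in\mathcal{L}_p^w(G)$ the convolution $f*g$ is defined (the integral converges absolutely for almost every $s$) and belongs to $\mathcal{L}_p^w(G)$. A group is $\sigma$-compact if it is a countable union of compact sets. *)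

(* Defs.v *)
From HB Require Import structures.
From mathcomp Require Import all_boot all_order all_algebra.
From mathcomp Require Import complex.
From mathcomp Require Import all_classical all_reals all_analysis.

Set Implicit Arguments.
Unset Strict Implicit.
Unset Printing Implicit Defensive.

Import Order.TTheory GRing.Theory Num.Theory.
Import numFieldNormedType.Exports.
Import ComplexField.Normc.

Local Open Scope classical_set_scope.
Local Open Scope ring_scope.

HB.mixin Record isTopologicalGroup G & Topological G & Group G := {
  mulg_continuous : continuous (fun z : G * G => (z.1 * z.2)%g) ;
  invg_continuous : continuous (fun x : G => (x^-1)%g)
}.

(* The base point of [PointedTopological] plays no role (a group is nonempty);
   it is there because a [measurableType] is pointed. *)
#[short(type="topologicalGroupType")]
HB.structure Definition TopologicalGroup :=
  { G of PointedTopological G & Group G & isTopologicalGroup G }.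

(* Hausdorff, as is customary for locally compact groups. *)
Definition locally_compact_group (G : topologicalGroupType) : Prop :=
  hausdorff_space G /\ locally_compact [set: G].

Definition sigma_compact (T : topologicalType) : Prop :=
  exists2 K : nat -> set T,
    forall n, compact (K n) & \bigcup_n K n = [set: T].

Notation borelType G := (g_sigma_algebraType (@open G)).

Section Haar.
Context (R : realType) (G : topologicalGroupType).
Variable mu : {measure set (borelType G) -> \bar R}.

(* A nonzero left-invariant Radon measure: finite on compact sets, outer
   regular on Borel sets and inner regular on open sets. *)
Record left_haar : Prop := LeftHaar {
  haar_neq0 : mu [set: G] <> 0%E ;
  haar_compact : forall K : set G, compact K -> (mu K < +oo)%E ;
  haar_invariant : forall (x : G) (A : set (borelType G)), measurable A ->
    mu [set (x * y)%g | y in (A : set G)] = mu A ;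
  haar_outer : forall A : set (borelType G), measurable A ->
    mu A = ereal_inf [set mu U | U in [set U : set G | open U /\ A `<=` U]] ;
  haar_inner : forall U : set G, open U ->
    mu U = ereal_sup [set mu K | K in [set K : set G | compact K /\ K `<=` U]]
}.

Definition complex_measurable (f : G -> R[i]) : Prop :=
  measurable_fun [set: borelType G] (fun x => complex.Re (f x)) /\
  measurable_fun [set: borelType G] (fun x => complex.Im (f x)).

Definition complex_integrable (f : G -> R[i]) : Prop :=
  complex_measurable f /\ (\int[mu]_x (normc (f x))%:E < +oo)%E.

Definition complex_integral (f : G -> R[i]) : R[i] :=
  Complex (\int[mu]_x complex.Re (f x)) (\int[mu]_x complex.Im (f x)).

(* Representatives of the elements of L_oo(G): no quotient is taken. *)
Definition Linfty : set (G -> R[i]) :=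
  [set f | complex_measurable f /\
     exists M : R, \forall x \ae mu, normc (f x) <= M].

(* In [R[i]], [0 <= z] says that [z] is real and
   nonnegative. Linearity and [mean_ge0] force [m] to agree on functions of
   [Linfty] that are equal almost everywhere, so [m] is a functional on the
   quotient; its values outside [Linfty] are irrelevant. *)
Record left_invariant_mean (m : (G -> R[i]) -> R[i]) : Prop :=
  LeftInvariantMean {
  mean_linear : forall (a : R[i]) (f g : G -> R[i]), Linfty f -> Linfty g ->
    m (fun x => a * f x + g x) = a * m f + m g ;
  mean_ge0 : forall f : G -> R[i], Linfty f ->
    (\forall x \ae mu, 0 <= f x) -> 0 <= m f ;
  mean_1 : m (fun=> 1) = 1 ;
  mean_invariant : forall (y : G) (f : G -> R[i]), Linfty f ->
    m (fun x => f (y^-1 * x)%g) = m f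
}.

Definition amenable : Prop := exists m, left_invariant_mean m.

Definition weight (w : G -> R) : Prop :=
  measurable_fun [set: borelType G] w /\ forall x, 0 < w x.

(* Representatives of the elements of the weighted space. *)
Definition Lpw (p : R) (w : G -> R) : set (G -> R[i]) :=
  [set f | complex_measurable f /\
     (\int[mu]_x ((normc (f x) * w x) `^ p)%:E < +oo)%E].

Definition convolution (f g : G -> R[i]) (s : G) : R[i] :=
  complex_integral (fun t => f t * g (t^-1 * s)%g).

(* The convolution is only determined almost everywhere, hence the
   representative [h]. *)
Definition Lpw_algebra (p : R) (w : G -> R) : Prop :=
  forall f g, Lpw p w f -> Lpw p w g ->
    (\forall s \ae mu, complex_integrable (fun t => f t * g (t^-1 * s)%g)) /\
    (exists2 h, Lpw p w h & \forall s \ae mu, convolution f g s = h s).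

End Haar.

(* Main.v *)
Require Import Defs.
From mathcomp Require Import all_boot all_order all_algebra.
From mathcomp Require Import all_classical all_reals all_analysis.
From mathcomp Require Import measurable_realfun ring lra complex.

Set Implicit Arguments.
Unset Strict Implicit.
Unset Printing Implicit Defensive.

Import Order.TTheory GRing.Theory Num.Theory.
Import numFieldNormedType.Exports.
Local Open Scope classical_set_scope.
Local Open Scope ring_scope.

(** The idea is clearest on a discrete group.  For a fixed [f >= 0] in the
    weighted space, [g |-> f * g] is bounded on nonnegative functions
    ([conv_bounded]).  Suppose that infinitely many [t i] satisfy [w (t i) <= L]
    and [w (t i)^-1 <= L].  As [1 < p], one can choose a single [f] in the space
    which, for every [m], is at least [beta ^ m] on [M ^ m] of the points [t i]
    and on their inverses, where [(M beta) ^ m] is unbounded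
    ([blocks_dominated]).  A Neumann series for the operator [g |-> f * g] gives
    a function [g] with [f * g <= kappa g] ([superharmonic_exists]), hence
    [beta ^ m \sum_i (g ((t i)^-1 s) + g (t i s)) <= 2 kappa g s] for all [s], with
    a [kappa] that does not depend on [m].  Thus [ln g] has bounded increments
    along the [t i].  Since [expR u >= 1 + u], an invariant mean can be applied
    to the logarithms; the increments along [t i] and along its inverse have
    opposite means, and what remains is [(M beta) ^ m <= kappa]
    ([log_mean_bound]), which is absurd for large [m].  So for every [L] only
    finitely many elements satisfy both bounds, and [G] is countable.  The
    argument uses the mean itself, without almost invariant vectors.

    In general the points [t i] become subsets of positive measure of disjoint
    translates of a compact neighbourhood [K] of the unit.  Values of [g] at
    points are replaced by the averages [h s = \int_K g (t^-1 s)]; adding to [f]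
    the indicator of a neighbourhood of the unit, which lies in the space by
    [finite_norm_nbhs1], yields a Harnack inequality for [h] ([harnack]) that
    makes [h] roughly constant on each [K s], and a finite partition of [K]
    turns the remaining average over [K] into finitely many translations
    ([discretized]).  The function [h] may vanish outside an open subgroup, from
    which it is copied to the cosets before taking the mean
    ([translates_bound]).

    Multiplication need not be measurable for the product of the Borel
    sigma-algebras and the measure need not be sigma-finite, so Fubini's theorem
    is avoided: convolution operators are only iterated, never reassociated, and
    the two facts that would come from Fubini, that inversion preserves null
    sets ([null_invmulg]) and that convolutions are measurable
    ([borel_fun_setconv]), are derived from the regularity of the measure. *)

(** * Topological groups *)

Section GroupTopology.
Context {G : topologicalGroupType}.
Implicit Types (x y s t : G) (A B K W X : set G).

Lemma continuous_mulg2 (T : topologicalType) (f g : T -> G) :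
  continuous f -> continuous g -> continuous (fun z => (f z * g z)%g).
Proof.
move=> cf cg z; have := @mulg_continuous G (f z, g z).
apply: (@continuous_comp _ _ _ (fun z => (f z, g z)) (fun z => (z.1 * z.2)%g)).
exact: cvg_pair (cf z) (cg z).
Qed.

Lemma continuous_lmulg x : continuous (fun t : G => (x * t)%g).
Proof. by apply: continuous_mulg2 => z; [exact: cvg_cst|exact: cvg_id]. Qed.

Lemma continuous_rmulg x : continuous (fun t : G => (t * x)%g).
Proof. by apply: continuous_mulg2 => z; [exact: cvg_id|exact: cvg_cst]. Qed.

Lemma continuous_invmulg s : continuous (fun t : G => (t^-1 * s)%g).
Proof. by apply: continuous_mulg2 => z; [exact: invg_continuous|exact: cvg_cst]. Qed.

(** The translate [x A], as a preimage: openness and measurability are then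
    immediate. *)
Definition ltrans x A : set G := [set t | A (x^-1 * t)%g].

Definition prodset A B : set G := [set (z.1 * z.2)%g | z in A `*` B].

Lemma mem_prodset A B x y : A x -> B y -> prodset A B (x * y)%g.
Proof. by move=> Ax By; exists (x, y). Qed.

Lemma ltrans_image x A : [set (x * y)%g | y in A] = ltrans x A.
Proof.
apply/seteqP; split=> [_ [y Ay <-]|t At]; first by rewrite /ltrans /= mulKg.
by exists (x^-1 * t)%g => //; rewrite mulVKg.
Qed.

Lemma nbhs_ltrans x W : nbhs (1%g : G) W -> nbhs x (ltrans x W).
Proof. by move=> W1; have := @continuous_lmulg x^-1%g x W; rewrite mulVg; exact. Qed.

Lemma compact_prodset A B : compact A -> compact B -> compact (prodset A B).
Proof.
move=> cA cB; apply: continuous_compact; last exact: compact_setX.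
by apply: continuous_subspaceT; exact: mulg_continuous.
Qed.

Lemma compact_ltrans x A : compact A -> compact (ltrans x A).
Proof.
move=> cA; rewrite -ltrans_image; apply: continuous_compact => //.
by apply: continuous_subspaceT; exact: continuous_lmulg.
Qed.

Lemma compact_invset A : compact A -> compact [set t | A t^-1%g].
Proof.
move=> cA; rewrite (_ : [set _ | _] = [set t^-1%g | t in A]); last first.
  apply/seteqP; split=> [t At|_ [t At <-]]; last by rewrite /= invgK.
  by exists t^-1%g => //; rewrite invgK.
apply: continuous_compact => //.
by apply: continuous_subspaceT; exact: invg_continuous.
Qed.

Lemma nbhs1_mul W : nbhs (1%g : G) W ->
  exists2 V, nbhs (1%g : G) V & forall x y, V x -> V y -> W (x * y)%g.
Proof.
move=> W1; have := @mulg_continuous G (1%g, 1%g) W; rewrite /= mulg1 => /(_ W1).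
move=> [[A B] [/= A1 B1] AB]; exists (A `&` B); first exact: filterI.
by move=> x y [Ax _] [_ By]; exact: (AB (x, y)).
Qed.

Lemma nbhs1_inv W : nbhs (1%g : G) W -> nbhs (1%g : G) [set t | W t^-1%g].
Proof. by move=> W1; have := @invg_continuous G 1%g W; rewrite invg1; exact. Qed.

Lemma nbhs1_conj x W : nbhs (1%g : G) W ->
  nbhs (1%g : G) [set v | W (x * v * x^-1)%g].
Proof.
move=> W1; have : continuous (fun v : G => (x * v * x^-1)%g).
  by apply: continuous_mulg2; [exact: continuous_lmulg|exact: cst_continuous].
by move=> /(_ 1%g W); rewrite mulg1 mulgV; exact.
Qed.

(** The closure of a symmetric neighbourhood [A] of the unit lies in [A A], so it
    can be made small; intersecting it with a compact neighbourhood of the unit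
    and with its own inverse gives [K]. *)
Lemma compact_symmetric_nbhs1 W : locally_compact_group G ->
  nbhs (1%g : G) W ->
  exists K, [/\ compact K, nbhs (1%g : G) K, forall x, K x -> K x^-1%g &
    forall x y z, K x -> K y -> K z -> W (x * y * z)%g].
Proof.
move=> [hG lc] W1.
have [W2 W21 W2W] := nbhs1_mul W1.
have [W3 W31 W3W] := nbhs1_mul W21.
have [V V1 VW] := nbhs1_mul W31.
have [C C1 [cC clC]] : exists2 C : set G, nbhs (1%g : G) C & compact C /\ closed C.
  have [C C1 CC] := lc (1%g : G) I; exists C => //.
  move: C1; rewrite /within /=; apply: filterS => y; exact.
pose A := V `&` [set t | V t^-1%g].
have A1 : nbhs (1%g : G) A by apply: filterI => //; exact: nbhs1_inv.
pose K0 := C `&` closure A.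
have K01 : nbhs (1%g : G) K0.
  apply: filterI => //; apply: filterS A1; exact: subset_closure.
have clK0 : closed K0 by apply: closedI => //; exact: closed_closure.
have K0W x : K0 x -> W3 x.
  move=> [_ Ax]; have [t [At]] := Ax _ (nbhs_ltrans x A1).
  rewrite /ltrans /= => -[_]; rewrite /= invgM invgK => Vx.
  by have := VW _ _ At.1 Vx; rewrite mulVKg.
pose K := K0 `&` [set t | K0 t^-1%g].
exists K; split.
- apply: (subclosed_compact _ cC); last by move=> x [[]].
  apply: closedI => //; apply: closed_comp => // x _; exact: invg_continuous.
- by apply: filterI => //; exact: nbhs1_inv.
- by move=> x [Kx Kx']; split => //=; rewrite invgK.
- move=> x y z [Kx _] [Ky _] [Kz _]; apply: W2W.
    by apply: W3W; exact: K0W.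
  by rewrite -[z]mulg1; apply: W3W; [exact: K0W|exact: nbhs_singleton].
Qed.

(** The sets [Y j] serve as the cells of Riemann sums: on a cell the variable
    differs from [x j] only by an element of [W]. *)
Lemma compact_partition X W : compact X -> nbhs (1%g : G) W -> hausdorff_space G ->
  exists n (x : nat -> G) (Y : nat -> set G),
  [/\ forall j, measurable (Y j : set (borelType G)),
      trivIset [set: nat] Y,
      forall j, (j < n)%N -> X (x j),
      forall j t, Y j t -> W ((x j)^-1 * t)%g &
      X = \big[setU/set0]_(j < n) Y j].
Proof.
move=> cX W1 hG; move: (cX); rewrite compact_cover.
move=> /(_ G X (fun x => interior (ltrans x W))) [].
- by move=> x _; exact: open_interior.
- by move=> x Xx; exists x => //; exact: nbhs_ltrans.
move=> D DX XD.
pose s := finmap.enum_fset D.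
pose F j : set G := if (j < size s)%N then X `&` interior (ltrans (nth 1%g s j) W)
  else set0.
have mF j : measurable (F j : set (borelType G)).
  rewrite /F; case: ifPn => _; last exact: measurable0.
  apply: measurableI; last by apply: sub_sigma_algebra; exact: open_interior.
  rewrite -[X]setCK; apply: measurableC; apply: sub_sigma_algebra.
  by apply: closed_openC; exact: compact_closed.
exists (size s), (nth 1%g s), (seqDU F); split.
- move=> j; apply: measurableD => //; apply: bigsetU_measurable => //.
- exact: trivIset_seqDU.
- by move=> j js; have := DX _ (mem_nth 1%g js); rewrite inE.
- move=> j t [Fj _]; move: Fj; rewrite /F; case: ifPn => // js [_].
  by move=> /interior_subset.
- rewrite -bigsetU_seqDU -bigcup_mkord; apply/seteqP; split=> [t Xt|t [j js]]; last first.
    by rewrite /F js => -[].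
  have [x /= xD xt] := XD _ Xt.
  exists (index x s) => /=; first by rewrite index_mem.
  by rewrite /F index_mem xD; split => //; rewrite nth_index.
Qed.

End GroupTopology.

(** * Borel sets and regularity of Haar measure *)

(** Borel sets are named on [G] itself, so that topological and measurable
    statements about the same set do not switch between two types. *)
Definition borel (G : topologicalGroupType) (A : set G) : Prop :=
  measurable (A : set (borelType G)).

Section BorelGroup.
Context {G : topologicalGroupType}.
Implicit Types A B K U : set G.

Lemma open_borel A : open A -> borel A.
Proof. exact: sub_sigma_algebra. Qed.

Lemma borelI A B : borel A -> borel B -> borel (A `&` B).
Proof. exact: measurableI. Qed.

Lemma closed_borel A : closed A -> borel A.
Proof.
by move=> cA; rewrite -[A]setCK; apply: measurableC; apply: open_borel; exact: closed_openC.
Qed.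

Lemma compact_borel A : hausdorff_space G -> compact A -> borel A.
Proof. by move=> hG cA; apply: closed_borel; exact: compact_closed. Qed.

Lemma continuous_borel (f : G -> G) : continuous f ->
  measurable_fun setT (f : borelType G -> borelType G).
Proof.
move=> cf; apply: (@measurability _ _ (borelType G) (borelType G) setT f (@open G)) => // _ [B oB <-].
by rewrite setTI; apply: open_borel; apply: open_comp => // x _; exact: cf.
Qed.

Lemma borel_preimage (f : G -> G) A : continuous f -> borel A -> borel (f @^-1` A).
Proof.
by move=> cf mA; have := continuous_borel cf measurableT mA; rewrite setTI.
Qed.

Lemma compact_open_nbhs1 K U : compact K -> open U -> K `<=` U ->
  nbhs (1%g : G) [set u | forall t, K t -> U (u * t)%g].
Proof.
move=> cK oU KU; have /near_covering_withinP := (compact_near_coveringP K).1 cK.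
move=> /(_ G (nbhs (1%g : G)) (fun u t => U (u * t)%g)) H.
apply: filterS (H _ _) => // t Kt.
have := @mulg_continuous G (1%g, t) U.
rewrite /= mul1g => /(_ _) [|[A B] [/= A1 Bt] AB].
  by apply: open_nbhs_nbhs; split => //; exact: KU.
exists (B, A); first by split.
by move=> [t' u] /= [Bt' Au] _; apply: (AB (u, t')).
Qed.

Lemma borel_ltrans x A : borel A -> borel (ltrans x A).
Proof. by apply: borel_preimage; exact: continuous_lmulg. Qed.

End BorelGroup.

Section HaarRegularity.
Context {R : realType} {G : topologicalGroupType}.
Context {mu : {measure set (borelType G) -> \bar R}}.
Hypotheses (hG : locally_compact_group G) (hmu : left_haar mu).
Implicit Types (A B K S : set G) (x s : G).
Local Open Scope ereal_scope.

Lemma haar_le A B : borel A -> borel B -> A `<=` B -> mu A <= mu B.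
Proof. by move=> mA mB AB; apply: le_measure; rewrite ?inE. Qed.

Lemma haarD A B : borel A -> borel B -> mu A < +oo -> B `<=` A ->
  mu (A `\` B) = mu A - mu B.
Proof.
by move=> mA mB Aoo BA; have := measureD mA mB Aoo; rewrite (setIidr BA).
Qed.

Lemma haarU2 A B : borel A -> borel B -> mu (A `|` B) <= mu A + mu B.
Proof. by move=> mA mB; exact: measureU2. Qed.

Lemma haarUI A B : borel A -> borel B -> mu B < +oo ->
  mu (A `|` B) = mu A + mu B - mu (A `&` B).
Proof. by move=> mA mB Boo; exact: measureUfinr. Qed.

Lemma haar_ltrans x A : borel A -> mu (ltrans x A) = mu A.
Proof. by move=> mA; rewrite -ltrans_image; exact: haar_invariant. Qed.

Lemma haar_fin K : compact K -> mu K \is a fin_num.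
Proof. by move=> cK; rewrite ge0_fin_numE//; exact: haar_compact hmu _ cK. Qed.

Lemma haar_outer_open A (e : R) : borel A -> mu A < e%:E ->
  exists U, [/\ open U, A `<=` U & mu U < e%:E].
Proof.
move=> mA; rewrite (haar_outer hmu)// => /ereal_inf_lt [_ [U [oU AU] <-] Ue].
by exists U.
Qed.

(** The definition of Haar measure gives inner regularity for open sets only.  A
    set of finite measure inherits it: take a compact subset of an open superset
    and remove an open set of small measure covering the excess. *)
Lemma haar_inner_compact S (a : R) : borel S -> mu S < +oo -> a%:E < mu S ->
  exists K, [/\ compact K, K `<=` S & a%:E < mu K].
Proof.
move=> mS Soo aS.
have Sfin : mu S \is a fin_num by rewrite ge0_fin_numE.
pose m := fine (mu S); have mE : mu S = m%:E by rewrite fineK.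
pose e := ((m - a) / 2)%R.
have am : (a < m)%R by rewrite -lte_fin -mE.
have epos : (0 < e)%R by rewrite /e divr_gt0 // subr_gt0.
have [Q [oQ SO muO]] : exists U, [/\ open U, S `<=` U & mu U < (m + e)%:E].
  by apply: haar_outer_open; rewrite ?mE ?lte_fin ?ltrDl.
have mQ := open_borel oQ.
have Ofin : mu Q \is a fin_num.
  by rewrite ge0_fin_numE//; apply: lt_trans muO _; rewrite ltry.
have [U [oU OSU muU]] : exists U, [/\ open U, Q `\` S `<=` U & mu U < e%:E].
  apply: haar_outer_open; first exact: measurableD.
  rewrite haarD//; last by rewrite -ge0_fin_numE.
  by rewrite mE lteBlDr// -EFinD addrC.
have [K0 [cK0 K0O] muK0] : exists2 K, compact K /\ K `<=` Q & mu Q - e%:E < mu K.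
  have : mu Q - e%:E < mu Q by rewrite lteBlDr// lteDl// lte_fin.
  by rewrite {2}(haar_inner hmu oQ) => /ereal_sup_gt[_ [K cK <-]] ?; exists K.
have mK0 := compact_borel hG.1 cK0.
have mU := open_borel oU.
exists (K0 `\` U); split.
- rewrite setDE; apply: compact_closedI => //; exact: open_closedC.
- move=> t [Kt nUt]; apply: contrapT => nSt; apply: nUt; apply: OSU; split=> //.
  exact: K0O.
have mK : borel (K0 `\` U) by exact: measurableD.
have : mu S <= mu (K0 `\` U) + (mu (Q `\` K0) + mu U).
  apply: (@le_trans _ _ (mu ((K0 `\` U) `|` ((Q `\` K0) `|` U)))).
    apply: haar_le => //; first by do 2! apply: measurableU => //; exact: measurableD.
    move=> t St; have [Ut|nUt] := pselect (U t); first by right; right.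
    by have [Kt|nKt] := pselect (K0 t); [left|right; left; split => //; exact: SO].
  have mOK : borel (Q `\` K0) by exact: measurableD.
  by apply: le_trans (haarU2 _ _) _ => //; [exact: measurableU|rewrite leeD2l// haarU2].
rewrite (haarD mQ mK0 _ K0O); last by rewrite -ge0_fin_numE.
rewrite mE.
have K0fin := haar_fin cK0.
have Ufin : mu U \is a fin_num.
  by rewrite ge0_fin_numE//; apply: lt_trans muU _; rewrite ltry.
have Kfin : mu (K0 `\` U) \is a fin_num.
  rewrite ge0_fin_numE//; apply: le_lt_trans (haar_compact hmu cK0).
  by apply: haar_le => // t [].
move: muU muK0.
rewrite -(fineK Kfin) -(fineK K0fin) -(fineK Ufin) -(fineK Ofin).
rewrite -!EFinB -!EFinD !lte_fin !lee_fin /e; lra.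
Qed.

(** For [u] near the unit, [K] and [u K] lie in a common open set of measure
    close to that of [K], so they must overlap. *)
Lemma haar_ltransI K (a : R) : compact K -> a%:E < mu K ->
  nbhs (1%g : G) [set u | a%:E < mu (K `&` ltrans u K)].
Proof.
move=> cK aK; have Kfin := haar_fin cK; have mK := compact_borel hG.1 cK.
pose m := fine (mu K); have mE : mu K = m%:E by rewrite fineK.
have am : (a < m)%R by rewrite -lte_fin -mE.
have [U [oU KU muU]] : exists U, [/\ open U, K `<=` U & mu U < (m + (m - a))%:E].
  by apply: haar_outer_open; rewrite ?mE ?lte_fin ?ltrDl ?subr_gt0.
have := compact_open_nbhs1 cK oU KU.
apply: filterS => u uKU; rewrite /mkset.
have muK : borel (ltrans u K) by exact: borel_ltrans.
have mKK : borel (K `&` ltrans u K) by exact: measurableI.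
have : mu (K `|` ltrans u K) <= mu U.
  apply: haar_le => //; [exact: measurableU|exact: open_borel|].
  move=> t [/KU//|]; rewrite /ltrans /= => /uKU.
  by rewrite /= mulVKg.
rewrite haarUI//; last by rewrite haar_ltrans// -ge0_fin_numE.
rewrite haar_ltrans//.
have KKfin : mu (K `&` ltrans u K) \is a fin_num.
  rewrite ge0_fin_numE//; apply: le_lt_trans (haar_compact hmu cK).
  by apply: haar_le => // t [].
have Ufin : mu U \is a fin_num.
  by rewrite ge0_fin_numE//; apply: lt_trans muU _; rewrite ltry.
move: muU; rewrite mE -(fineK KKfin) -(fineK Ufin).
rewrite -EFinD -?EFinB !lee_fin !lte_fin; lra.
Qed.

End HaarRegularity.

(** * Null sets and inversion *)

Section HaarNull.
Context {R : realType} {G : topologicalGroupType}.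
Context {mu : {measure set (borelType G) -> \bar R}}.
Hypotheses (hG : locally_compact_group G) (hmu : left_haar mu).
Implicit Types (A B K S : set G) (x s : G).
Local Open Scope ereal_scope.

Lemma haar_subadditive A n (Y : nat -> set G) : borel A ->
  (forall j, borel (Y j)) -> A `<=` \big[setU/set0]_(j < n) Y j ->
  mu A <= \sum_(j < n) mu (Y j).
Proof. by move=> mA mY AY; apply: content_subadditive => // k _; exact: mY. Qed.

(** Finitely many translates of a null neighbourhood would cover any given
    compact set, and the measure would vanish by inner regularity. *)
Lemma haar_nbhs_gt0 x A : borel A -> nbhs x A -> 0 < mu A.
Proof.
move=> mA xA; rewrite measure_gt0; apply/eqP => A0.
have W1 : nbhs (1%g : G) (ltrans x^-1%g A).
  have := @continuous_lmulg _ x 1%g A; rewrite mulg1 => /(_ xA) H.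
  apply: (@filterS _ (nbhs (1%g : G)) _ ((fun t => (x * t)%g) @^-1` A)) H.
  by move=> t At; rewrite /ltrans /= invgK.
have mW : borel (ltrans x^-1%g A) by exact: borel_ltrans.
have cpt0 K : compact K -> mu K = 0.
  move=> cK; have mK := compact_borel hG.1 cK.
  have [n [y [Y [mY _ _ YW KY]]]] := compact_partition cK W1 hG.1.
  apply/eqP; rewrite -measure_le0.
  apply: le_trans (haar_subadditive (n := n) mK mY _) _; first by rewrite -KY.
  rewrite big1// => j _; apply: subset_measure0 (_ : mu (ltrans (y j) (ltrans x^-1%g A)) = 0).
  - exact: mY.
  - exact: borel_ltrans.
  - by move=> t; exact: YW.
  - by rewrite !haar_ltrans.
apply: (haar_neq0 hmu); rewrite (haar_inner hmu openT).
apply/eqP; rewrite eq_le; apply/andP; split.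
  by apply: ge_ereal_sup => _ [K [cK _] <-]; rewrite cpt0.
by apply: ereal_sup_ubound; exists set0; [split; [exact: compact0|]|exact: measure0].
Qed.

(** A substitute for Fubini's theorem.  Put [N = K^-1 s], cover it by an open set
    [U] with [mu U < e], and partition [X = K s^-1 K] into cells [Y j] so small
    that [x^-1 y] in [N] implies [(x j)^-1 y] in [U] for [x] in [Y j].  For each
    [y] in [K] the [x] with [x^-1 y] in [N] form a translate of [K] inside [X], so
    the cells with [(x j)^-1 y] in [U] have total measure at least [mu K].
    Integrating over [y] gives [mu K * mu K <= mu X * e]. *)
Lemma compact_preimage_null K s : compact K ->
  mu [set t | K (s * t^-1)%g] = 0 -> mu K = 0.
Proof.
move=> cK; set N := [set t | _] => N0.
have mK := compact_borel hG.1 cK.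
have mN : borel N.
  apply: borel_preimage => //; apply: continuous_mulg2; first exact: cst_continuous.
  exact: invg_continuous.
have cN : compact N.
  have -> : N = prodset [set t | K t^-1%g] [set s].
    apply/seteqP; split => [t Nt|_ [[a b] /= [Ka ->] <-]].
      by rewrite -[t](mulgVK s); apply: mem_prodset => //=; rewrite invgM invgK.
    by rewrite /N /= invgM mulVKg.
  by apply: compact_prodset; [exact: compact_invset|exact: compact_set1].
pose X := prodset (prodset K [set s^-1%g]) K.
have cX : compact X.
  by do 2! apply: compact_prodset => //; exact: compact_set1.
have bound (e : R) : (0 < e)%R -> mu K * mu K <= mu X * e%:E.
  move=> epos; have [U [oU NU Ue]] : exists U, [/\ open U, N `<=` U & mu U < e%:E].
    by apply: (haar_outer_open hmu) => //; rewrite N0 lte_fin.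
  have mU := open_borel oU.
  have W1 := compact_open_nbhs1 cN oU NU.
  have [n [x [Y [mY tY xX YW XY]]]] := compact_partition cX W1 hG.1.
  pose f y : \bar R := \sum_(j < n) mu (Y j) * (\1_(ltrans (x j) U) y)%:E.
  have fK y : K y -> mu K <= f y.
    move=> Ky; rewrite -(haar_ltrans hmu (y * s^-1)%g mK).
    have mL : borel (ltrans (y * s^-1)%g K) by exact: borel_ltrans.
    apply: le_trans (haar_subadditive (Y := fun j => Y j `&` ltrans (y * s^-1)%g K) (n := n) mL _ _) _.
    - by move=> j; apply: borelI => //; exact: mY.
    - rewrite -big_distrl /= -XY => t Lt; split => //.
      by rewrite -[t](mulVKg (y * s^-1)%g); do ?apply: mem_prodset.
    apply: lee_sum => j _.
    have [->|/set0P[t [Yt Lt]]] := eqVneq (Y j `&` ltrans (y * s^-1)%g K) set0.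
      by rewrite measure0 mule_ge0.
    rewrite indicE mem_set ?mule1; first by apply: haar_le; [apply: borelI => //; exact: mY|exact: mY|move=> z []].
    rewrite /ltrans /=; rewrite -(mulVKg t y) mulgA; apply: (YW j t Yt).
    rewrite /N /= invgM invgK; move: Lt.
    by rewrite /ltrans /= invgM invgK mulgA.
  have fI : \int[mu]_(y in K) f y <= mu X * e%:E.
    rewrite ge0_integral_sum//; last first.
      move=> j; apply: measurable_funeM; apply/measurable_EFinP.
      by apply: measurable_indic; exact: borel_ltrans.
    rewrite XY (measure_bigsetU mu mY tY n) ge0_sume_distrl//.
    apply: lee_sum => j _.
    rewrite ge0_integralZl//; last first.
      apply/measurable_EFinP; apply: measurable_indic; exact: borel_ltrans.
    rewrite integral_indic//; last exact: borel_ltrans.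
    rewrite lee_pmul//; apply: le_trans (ltW Ue).
    rewrite -(haar_ltrans hmu (x j) mU); apply: haar_le.
    - by apply: borelI => //; exact: borel_ltrans.
    - exact: borel_ltrans.
    - by move=> t [].
  apply: le_trans fI; rewrite -integral_cst//; apply: ge0_le_integral => //.
  - apply: emeasurable_sum => j.
    apply: measurable_funeM; apply/measurable_EFinP.
    by apply: measurable_indic; exact: borel_ltrans.
have [k kE] : exists k, mu K = k%:E by exists (fine (mu K)); rewrite fineK// (haar_fin hmu).
have [r rE] : exists r, mu X = r%:E by exists (fine (mu X)); rewrite fineK// (haar_fin hmu).
have k0 : (0 <= k)%R by rewrite -lee_fin -kE.
have r0 : (0 <= r)%R by rewrite -lee_fin -rE.
move: bound; rewrite kE rE => bound; congr EFin.
have : (k * k <= 0)%R.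
  apply/ler_addgt0Pr => e epos; rewrite add0r.
  have := bound (e / (r + 1))%R; rewrite -!EFinM lee_fin.
  move=> /(_ (divr_gt0 epos _)) /le_trans; apply; first by rewrite ltr_wpDl.
  rewrite mulrCA; apply: ler_piMr; first exact: ltW.
  by rewrite ler_pdivrMr ?mul1r ?lerDl// ltr_wpDl.
rewrite -expr2 => kk; apply/eqP; rewrite -(@sqrf_eq0 R) eq_le kk /=.
by rewrite sqr_ge0.
Qed.

(** Inner regularity reduces this to compact sets; it is the reason for
    intersecting with a set [S] of finite measure. *)
Lemma null_invmulg A S s : borel A -> mu A = 0 -> borel S -> mu S < +oo ->
  mu (S `&` [set t | A (t^-1 * s)%g]) = 0.
Proof.
move=> mA A0 mS Soo; apply/eqP; apply/negPn/negP.
have mB : borel (S `&` [set t | A (t^-1 * s)%g]).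
  by apply: borelI => //; apply: borel_preimage => //; exact: continuous_invmulg.
rewrite -measure_gt0 => /(haar_inner_compact hG hmu mB)[].
  by apply: le_lt_trans Soo; apply: haar_le => // t [].
move=> K [cK KB K0]; suff K1 : mu K = 0 by move: K0; rewrite K1 ltxx.
apply: (@compact_preimage_null _ s cK).
apply: subset_measure0 A0 => //.
- apply: borel_preimage; last exact: compact_borel hG.1 _.
  by apply: continuous_mulg2; [exact: cst_continuous|exact: invg_continuous].
- by move=> t /= /KB[_ /=]; rewrite invgM invgK mulgVK.
Qed.

End HaarNull.

(** * Convolution with an indicator *)

Definition borel_fun (R : realType) (G : topologicalGroupType) (g : G -> \bar R) :=
  measurable_fun [set: borelType G] g.

(** The convolution of the indicator of [S] with [g], without any condition of
    finiteness. *)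
Definition setconv (R : realType) (G : topologicalGroupType)
    (mu : {measure set (borelType G) -> \bar R}) (S : set G) (g : G -> \bar R)
    (s : G) : \bar R :=
  (\int[mu]_(t in (S : set (borelType G))) g (t^-1 * s)%g)%E.

Section SetConvolution.
Context {R : realType} {G : topologicalGroupType}.
Context {mu : {measure set (borelType G) -> \bar R}}.
Hypotheses (hG : locally_compact_group G) (hmu : left_haar mu).
Implicit Types (A B K S T : set G) (x s : G) (f g : G -> \bar R).
Local Open Scope ereal_scope.

Lemma borel_fun_comp (phi : G -> G) g : continuous phi -> borel_fun g ->
  borel_fun (g \o phi).
Proof. by move=> cphi mg; exact: (measurableT_comp mg (continuous_borel cphi)). Qed.

Lemma borel_fun_invmulg s g : borel_fun g -> borel_fun (fun t => g (t^-1 * s)%g).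
Proof. exact: (borel_fun_comp (@continuous_invmulg G s)). Qed.

Lemma setconv_ge0 S g s : (forall x, 0 <= g x) -> 0 <= setconv mu S g s.
Proof. by move=> g0; apply: integral_ge0. Qed.

Lemma setconvS S T g s : borel S -> borel T -> borel_fun g -> (forall x, 0 <= g x) ->
  S `<=` T -> setconv mu S g s <= setconv mu T g s.
Proof.
move=> mS mT mg g0 ST; apply: ge0_subset_integral => //.
by apply: measurable_funTS; exact: (borel_fun_invmulg s mg).
Qed.

Lemma setconv_cst_le S g s (c : \bar R) : borel S -> borel_fun g -> 0 <= c ->
  (forall t, S t -> c <= g (t^-1 * s)%g) -> c * mu S <= setconv mu S g s.
Proof.
move=> mS mg c0 cg; rewrite -integral_cst//; apply: ge0_le_integral => //.
by apply: measurable_funTS; exact: (borel_fun_invmulg s mg).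
Qed.

Lemma setconv_le_cst S g s (c : \bar R) : borel S -> borel_fun g ->
  (forall x, 0 <= g x) ->
  (forall t, S t -> g (t^-1 * s)%g <= c) -> setconv mu S g s <= c * mu S.
Proof.
move=> mS mg g0 cg; rewrite -integral_cst//; apply: ge0_le_integral => //.
by apply: measurable_funTS; exact: (borel_fun_invmulg s mg).
Qed.

Lemma setconv_mull S g x s : borel S -> borel_fun g -> (forall x, 0 <= g x) ->
  setconv mu S g (x * s)%g = setconv mu (ltrans x^-1 S)%g g s.
Proof.
move=> mS mg g0.
have mphi := continuous_borel (@continuous_lmulg G x^-1%g).
have mD : borel (ltrans x^-1%g S) by exact: borel_ltrans.
transitivity (\int[pushforward mu (fun t : borelType G => (x^-1 * t)%g : borelType G)]_(y in
    (ltrans x^-1%g S : set (borelType G))) g (y^-1 * s)%g).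
  rewrite (ge0_integral_pushforward mphi mu mD) /=; last 2 first.
  - by apply: measurable_funTS; exact: (borel_fun_invmulg s mg).
  - by move=> y _; exact: g0.
  rewrite /setconv (_ : _ @^-1` _ = S); last first.
    by apply/seteqP; split => t; rewrite /ltrans /= invgK mulVKg.
  by apply: eq_integral => t _ /=; rewrite invgM invgK mulgA.
apply: eq_measure_integral => A mA _.
exact: (haar_ltrans hmu x mA).
Qed.

Lemma setconv_indic S A s : borel S -> borel A ->
  setconv mu S (fun x => (\1_A x)%:E) s = mu (S `&` [set t | A (t^-1 * s)%g]).
Proof.
move=> mS mA; rewrite /setconv setIC.
have mA' : borel [set t | A (t^-1 * s)%g].
  by apply: borel_preimage => //; exact: continuous_invmulg.
exact: (integral_indic mu mS mA').
Qed.

(** Inner regularity makes [s |-> mu (S `&` s A^-1)] lower semicontinuous: a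
    compact piece of the intersection survives small left translations. *)
Lemma setconv_indic_open S A (a : R) : borel S -> mu S < +oo -> borel A ->
  open [set s | a%:E < setconv mu S (fun x => (\1_A x)%:E) s].
Proof.
move=> mS Soo mA; rewrite openE => s /=; rewrite setconv_indic// => sa.
have mA' r : borel [set t | A (t^-1 * r)%g].
  by apply: borel_preimage => //; exact: continuous_invmulg.
have [|K [cK KS aK]] := haar_inner_compact hG hmu (borelI mS (mA' s)) _ sa.
  by apply: le_lt_trans Soo; apply: haar_le; [exact: (borelI mS (mA' s))|exact: mS|move=> t []].
have K1 := haar_ltransI hG hmu cK aK.
rewrite /interior.
have : nbhs s [set r | a%:E < mu (K `&` ltrans (r * s^-1)%g K)].
  have := @continuous_rmulg G s^-1%g s [set u | a%:E < mu (K `&` ltrans u K)].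
  by rewrite mulgV => /(_ K1).
apply: filterS => r /= ar; rewrite setconv_indic//.
apply: lt_le_trans ar _; apply: haar_le.
- by apply: borelI; [exact: compact_borel hG.1 cK|apply: borel_ltrans; exact: compact_borel hG.1 cK].
- exact: borelI.
- move=> t [/KS[St _]]; rewrite /ltrans /= => /KS[_ /=].
  by rewrite invgM !invgK -!mulgA mulVg mulg1.
Qed.

Lemma borel_fun_open_ray f : (forall a : R, open [set s | a%:E < f s]) -> borel_fun f.
Proof.
move=> of_; apply: (measurability _ (ErealGenOInfty.measurableE R)).
move=> /= _ [_ [a ->]] <-; apply: borelI; first exact: measurableT.
by apply: open_borel; rewrite preimage_itvoy; exact: of_.
Qed.

Lemma borel_fun_setconv_indic S A : borel S -> mu S < +oo -> borel A ->
  borel_fun (setconv mu S (fun x => (\1_A x)%:E)).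
Proof. by move=> mS Soo mA; apply: borel_fun_open_ray => a; exact: setconv_indic_open. Qed.

Import HBNNSimple.

(** Measurability of an integral in a parameter usually comes from joint
    measurability, which may fail here; for indicators it comes from
    semicontinuity, and then for all nonnegative functions by approximation. *)
Lemma borel_fun_setconv S g : borel S -> mu S < +oo -> borel_fun g ->
  (forall x, 0 <= g x) -> borel_fun (setconv mu S g).
Proof.
move=> mS Soo mg g0.
pose h n : {nnsfun (borelType G) >-> R} := nnsfun_approx measurableT mg n.
have mh n : borel_fun (fun x => (h n x)%:E) by apply/measurable_EFinP.
have mhS n s : measurable_fun (S : set (borelType G)) (fun t : borelType G => (h n (t^-1 * s)%g)%:E).
  by apply: measurable_funTS; exact: (borel_fun_invmulg s (mh n)).
apply: (@emeasurable_fun_cvg _ (borelType G) R setT (fun n => setconv mu S (fun x => (h n x)%:E))).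
- move=> n.
  pose c := finmap.enum_fset (fset_set (range (h n))).
  pose H (i : nat) := h n @^-1` [set c`_i].
  have mH i : borel (H i) by exact: measurable_funPTI.
  pose F (i : nat) x : \bar R := ((c`_i)%:E * (\1_(H i) x)%:E).
  have F0 i x : 0 <= F i x.
    rewrite /F indicE; have [/set_mem /= <-|_] := boolP (x \in H i); last by rewrite mule0.
    by rewrite mule1 lee_fin.
  have mF i : borel_fun (F i).
    by apply: measurable_funeM; apply/measurable_EFinP; apply: measurable_indic; exact: mH.
  rewrite (_ : setconv _ _ _ = fun s => \sum_(i < size c) setconv mu S (F i) s).
    apply: emeasurable_sum => i.
    have [c0|c0] := leP 0%R c`_i.
      rewrite (_ : setconv _ _ _ = fun s => (c`_i)%:E * setconv mu S (fun x => (\1_(H i) x)%:E) s).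
        by apply: measurable_funeM; exact: borel_fun_setconv_indic.
      apply/funext => s; rewrite /setconv -ge0_integralZl//.
      apply: measurable_funTS; apply: (borel_fun_invmulg s (g := fun x => (\1_(H i) x)%:E)).
      by apply/measurable_EFinP; apply: measurable_indic; exact: mH.
    rewrite (_ : setconv _ _ _ = cst 0); first exact: measurable_cst.
    apply/funext => s; rewrite /setconv integral0_eq// => t _.
    rewrite /F indicE memNset ?mule0// /H /= => hE.
    by move: c0; rewrite -hE ltNge fun_ge0.
  apply/funext => s; rewrite /setconv -ge0_integral_sum//.
    apply: eq_integral => t _; rewrite fimfunEord -sumEFin.
    by apply: eq_bigr => i _; rewrite EFinM.
  by move=> i; apply: measurable_funTS; exact: (borel_fun_invmulg s (mF i)).
- move=> s _; rewrite (_ : setconv mu S g s =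
      \int[mu]_(t in (S : set (borelType G))) limn (fun n => (h n (t^-1 * s)%g)%:E)).
    apply: cvg_monotone_convergence => //.
    - by move=> n t _; rewrite lee_fin fun_ge0.
    - by move=> t _ m n mn; rewrite lee_fin; have /lefP := nd_nnsfun_approx measurableT mg mn.
  apply: eq_integral => t _; apply/esym/cvg_lim => //.
  exact: (cvg_nnsfun_approx measurableT mg (fun x _ => g0 x)).
Qed.

End SetConvolution.

(** * The weighted space *)

Import ComplexField.Normc.

Section ComplexFacts.
Context {R : rcfType}.

Lemma normc_real (a : R) : normc (Complex a 0) = `|a|.
Proof. by rewrite /normc expr0n /= addr0 sqrtr_sqr. Qed.

Lemma ge_normc_Re (z : R[i]) : `|complex.Re z| <= normc z.
Proof.
case: z => a b /=; rewrite -sqrtr_sqr; apply: ler_wsqrtr.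
by rewrite lerDl sqr_ge0.
Qed.

Lemma mul_complex_real (a b : R) : Complex a 0 * Complex b 0 = Complex (a * b) 0.
Proof. by rewrite /GRing.mul /=; simpc; congr Complex; ring. Qed.

End ComplexFacts.

Section AlmostEverywhere.
Context {R : realType} {G : topologicalGroupType}.
Context {mu : {measure set (borelType G) -> \bar R}}.
Implicit Types P Q T : G -> Prop.

Lemma haar_ae_imply P Q : (forall x, P x -> Q x) ->
  (\forall x \ae mu, P x) -> \forall x \ae mu, Q x.
Proof. move=> PQ; exact: (@filterS _ (almost_everywhere mu)). Qed.

Lemma haar_ae_imply2 P Q T : (forall x, P x -> Q x -> T x) ->
  (\forall x \ae mu, P x) -> (\forall x \ae mu, Q x) -> \forall x \ae mu, T x.
Proof. move=> PQT; exact: (@filterS2 _ (almost_everywhere mu)). Qed.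

Lemma haar_ae_outside P (Z : set G) : borel Z -> mu Z = 0%E ->
  (forall x, ~ Z x -> P x) -> \forall x \ae mu, P x.
Proof. by move=> mZ Z0 ZP; exists Z; split => // x /= nP; apply: contrapT => /ZP. Qed.

End AlmostEverywhere.

Section WeightedSpace.
Context {R : realType} {G : topologicalGroupType}.
Context {mu : {measure set (borelType G) -> \bar R}}.
Hypotheses (hG : locally_compact_group G) (hmu : left_haar mu).
Context {w : G -> R} {p : R}.
Hypotheses (hw : weight w) (p1 : 1 < p).
Implicit Types (A B K S T : set G) (x s : G) (f g k : G -> R).

Let p0 : 0 < p. Proof. exact: lt_trans p1. Qed.

Let ww x : 0 <= w x. Proof. by apply: ltW; exact: hw.2. Qed.

Definition borel_rfun f := measurable_fun [set: borelType G] f.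

(** This is the [p]-th power of the weighted norm: only its monotonicity and
    homogeneity matter, so no root is taken. *)
Definition lpw_norm f : \bar R := (\int[mu]_x ((f x * w x) `^ p)%:E)%E.

Definition Lpos f := [/\ borel_rfun f, forall x, 0 <= f x & (lpw_norm f < +oo)%E].

Definition conv f g s : \bar R := (\int[mu]_t (f t * g (t^-1 * s)%g)%:E)%E.

Lemma borel_lpw f : borel_rfun f -> borel_rfun (fun x => (f x * w x) `^ p).
Proof.
move=> mf; apply: (measurableT_comp (measurable_powR p)).
exact: measurable_funM mf hw.1.
Qed.

Lemma borel_rfun_comp (phi : G -> G) f : continuous phi -> borel_rfun f ->
  borel_rfun (f \o phi).
Proof. by move=> cphi mf; exact: (measurableT_comp mf (continuous_borel cphi)). Qed.

Lemma borel_conv f g s : borel_rfun f -> borel_rfun g ->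
  borel_fun (fun t => (f t * g (t^-1 * s)%g)%:E).
Proof.
move=> mf mg; apply/measurable_EFinP; apply: measurable_funM => //.
exact: (borel_rfun_comp (@continuous_invmulg G s)).
Qed.

Lemma lpw_norm_ge0 f : (0 <= lpw_norm f)%E.
Proof. by apply: integral_ge0 => x _; rewrite lee_fin powR_ge0. Qed.

Lemma le_lpw_norm f g : borel_rfun f -> borel_rfun g -> (forall x, 0 <= f x) ->
  (\forall x \ae mu, f x <= g x) -> (lpw_norm f <= lpw_norm g)%E.
Proof.
move=> mf mg f0 fg; apply: ae_ge0_le_integral => //.
- by move=> x _; rewrite lee_fin powR_ge0.
- by apply/measurable_EFinP; exact: borel_lpw.
- by move=> x _; rewrite lee_fin powR_ge0.
- by apply/measurable_EFinP; exact: borel_lpw.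
- apply: haar_ae_imply fg => x fgx _; rewrite lee_fin.
  apply: ge0_ler_powR; first exact: ltW.
  - by rewrite nnegrE mulr_ge0.
  - by rewrite nnegrE mulr_ge0//; exact: le_trans (f0 x) fgx.
  - by rewrite ler_wpM2r.
Qed.

Lemma lpw_normZ (a : R) f : borel_rfun f -> (forall x, 0 <= f x) -> 0 <= a ->
  lpw_norm (fun x => a * f x) = ((a `^ p)%:E * lpw_norm f)%E.
Proof.
move=> mf f0 a0; rewrite /lpw_norm -ge0_integralZl_EFin ?powR_ge0//.
- by apply: eq_integral => x _; rewrite -mulrA powRM ?mulr_ge0// EFinM.
- by move=> x _; rewrite lee_fin powR_ge0.
- by apply/measurable_EFinP; exact: borel_lpw.
Qed.

(** The convolution hypothesis, read on nonnegative functions: the integral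
    itself, not only some representative, has finite weighted norm. *)
Lemma algebra_conv f g : Lpw_algebra mu p w -> Lpos f -> Lpos g ->
  exists2 k, Lpos k & \forall s \ae mu, conv f g s = (k s)%:E.
Proof.
move=> alg [mf f0 foo] [mg g0 goo].
have LC u : Lpos u -> Lpw mu p w (fun x => Complex (u x) 0).
  move=> [mu' u0 uoo]; split; first by split; [exact: mu'|exact: measurable_cst].
  suff -> : (\int[mu]_x ((normc (Complex (u x) 0) * w x) `^ p)%:E)%E = lpw_norm u.
    exact: uoo.
  by apply: eq_integral => x _; rewrite normc_real ger0_norm.
have [ci [h [[mhr mhi] hoo] hE]] := alg _ _ (LC f (And3 mf f0 foo)) (LC g (And3 mg g0 goo)).
pose k x := `|complex.Re (h x)|.
have mk : borel_rfun k by exact: measurableT_comp.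
exists k; first (split; [exact: mk|by move=> x; exact: normr_ge0|]).
  apply: le_lt_trans hoo; apply: ge0_le_integral => //.
  - by move=> x _; rewrite lee_fin powR_ge0.
  - by apply/measurable_EFinP; exact: borel_lpw.
  - apply/measurable_EFinP; apply: (measurableT_comp (measurable_powR p)).
    apply: measurable_funM; last exact: hw.1.
    rewrite (_ : (fun _ => _) = fun x =>
       (complex.Re (h x) ^+ 2 + complex.Im (h x) ^+ 2) `^ 2^-1).
      apply: (measurableT_comp (measurable_powR 2^-1)).
      by apply: measurable_funD; exact: measurable_funX.
    apply/funext => x; rewrite powR12_sqrt ?addr_ge0 ?sqr_ge0//.
    by case: (h x).
  - move=> x _; rewrite lee_fin; apply: ge0_ler_powR; first exact: ltW.
    + by rewrite nnegrE mulr_ge0// /k normr_ge0.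
    + by rewrite nnegrE mulr_ge0//; case: (h x) => a b /=; exact: sqrtr_ge0.
    + by rewrite ler_wpM2r// ge_normc_Re.
apply: haar_ae_imply2 ci hE => s [_ cis] hEs.
rewrite /k -hEs /convolution /complex_integral /= /Rintegral.
have e : (\int[mu]_x (complex.Re (Complex (f x) 0 * Complex (g (x^-1 * s)%g) 0))%:E)%E = conv f g s.
  by apply: eq_integral => x _; rewrite mul_complex_real.
have e2 : (\int[mu]_x (normc (Complex (f x) 0 * Complex (g (x^-1 * s)%g) 0))%:E)%E = conv f g s.
  by apply: eq_integral => x _; rewrite mul_complex_real normc_real ger0_norm// mulr_ge0.
have c0 : (0 <= conv f g s)%E by apply: integral_ge0 => t _; rewrite lee_fin mulr_ge0.
have cfin : conv f g s \is a fin_num by rewrite ge0_fin_numE// -e2.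
by rewrite e ger0_norm ?fine_ge0// fineK.
Qed.

(** The [p]-th root of the sum of the [p]-th powers [(F n * w) `^ p], divided by
    [w], is the required upper bound wherever the sum is finite. *)
Lemma summable_dominated (F : nat -> G -> R) : (forall n, borel_rfun (F n)) ->
  (forall n x, 0 <= F n x) ->
  (\sum_(n <oo) lpw_norm (F n) < +oo)%E ->
  exists f Z, [/\ Lpos f, borel Z, mu Z = 0%E &
    forall n x, ~ Z x -> F n x <= f x].
Proof.
move=> mF F0 Foo.
pose S x : \bar R := (\sum_(n <oo) ((F n x * w x) `^ p)%:E)%E.
have S0 x : (0 <= S x)%E by apply: nneseries_ge0 => n _ _; rewrite lee_fin powR_ge0.
have mS : borel_fun S.
  apply: ge0_emeasurable_sum => //; first by move=> n x _ _; rewrite lee_fin powR_ge0.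
  by move=> n _; apply/measurable_EFinP; exact: borel_lpw.
have IS : (\int[mu]_x S x = \sum_(n <oo) lpw_norm (F n))%E.
  rewrite integral_nneseries//.
  - by move=> n; apply/measurable_EFinP; exact: borel_lpw.
  - by move=> n x _; rewrite lee_fin powR_ge0.
have intS : mu.-integrable setT S.
  apply/integrableP; split => //; under eq_integral do rewrite gee0_abs//.
  by rewrite IS.
have [Z [mZ Z0 SZ]] := integrable_ae measurableT intS.
have Sfin x : ~ Z x -> S x \is a fin_num.
  by move=> nZ; apply: contrapT => nS; apply: nZ; apply: SZ => /= /(_ I).
pose f x := (fine (S x)) `^ p^-1 / w x.
have fE x : (f x * w x) `^ p = fine (S x).
  rewrite /f mulfVK ?gt_eqF ?hw.2// -powRrM mulVf ?gt_eqF// powRr1//.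
  exact: fine_ge0.
have mf : borel_rfun f.
  apply: measurable_funM.
    apply: (measurableT_comp (measurable_powR p^-1)).
    exact: (measurableT_comp (fine_measurable _) mS).
  rewrite (_ : (fun _ => _) = fun x => w x `^ (-1)).
    exact: (measurableT_comp (measurable_powR (-1)) hw.1).
  by apply/funext => x; rewrite powR_inv1.
exists f, Z; split => //.
  split => //; first by move=> x; rewrite divr_ge0 ?powR_ge0.
  apply: le_lt_trans Foo; rewrite -IS; apply: ge0_le_integral => //.
  - by move=> x _; rewrite lee_fin powR_ge0.
  - by apply/measurable_EFinP; exact: borel_lpw.
  - move=> x _; rewrite fE; have := S0 x.
    by case: (S x) => [r _|_|]//=; rewrite ?lexx ?leey.
move=> n x nZ; rewrite ler_pdivlMr ?hw.2//.
have x0 : 0 <= F n x * w x by rewrite mulr_ge0.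
rewrite -[leLHS](_ : ((F n x * w x) `^ p) `^ p^-1 = _); last first.
  by rewrite -powRrM mulfV ?gt_eqF// powRr1.
apply: ge0_ler_powR.
- by rewrite invr_ge0 ltW.
- by rewrite nnegrE powR_ge0.
- by rewrite nnegrE fine_ge0.
rewrite -lee_fin fineK; last exact: Sfin.
rewrite /S; apply: le_trans (nneseries_lim_ge n.+1 _); last first.
  by move=> m _ _; rewrite lee_fin powR_ge0.
rewrite big_nat_recr//= leeDr// sume_ge0// => m _.
by rewrite lee_fin powR_ge0.
Qed.

End WeightedSpace.

(** * Boundedness of convolution *)

Section ConvolutionBound.
Context {R : realType} {G : topologicalGroupType}.
Context {mu : {measure set (borelType G) -> \bar R}}.
Hypotheses (hG : locally_compact_group G) (hmu : left_haar mu).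
Context {w : G -> R} {p : R}.
Hypotheses (hw : weight w) (p1 : 1 < p) (alg : Lpw_algebra mu p w).
Implicit Types (A B K S T Z : set G) (x s t : G) (f g k : G -> R).

Local Notation lpw_norm := (lpw_norm (mu := mu) (w := w) (p := p)).
Local Notation Lpos := (Lpos (mu := mu) (w := w) (p := p)).
Local Notation conv := (conv (mu := mu)).

Let p0 : 0 < p. Proof. exact: lt_trans p1. Qed.

Let ww x : 0 <= w x. Proof. by apply: ltW; exact: hw.2. Qed.

(** By Markov's inequality.  The pieces of finite measure are what
    [null_invmulg] requires. *)
Lemma lpos_support f : Lpos f -> exists S : nat -> set G,
  [/\ forall n, borel (S n), forall n, (mu (S n) < +oo)%E &
      forall t, f t != 0 -> exists n, S n t].
Proof.
move=> [mf f0 foo].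
pose F t := (f t * w t) `^ p.
pose S (n : nat) := [set t | n.+1%:R^-1 <= F t].
have mF : borel_rfun F by exact: borel_lpw.
have mS n : borel (S n).
  rewrite (_ : S n = F @^-1` `[n.+1%:R^-1, +oo[%classic).
    by have := mF measurableT _ (measurable_itv `[n.+1%:R^-1, +oo[); rewrite setTI.
  by apply/seteqP; split => t /=; rewrite in_itv /= andbT.
exists S; split => //.
- move=> n; have : (n.+1%:R^-1%:E * mu (S n) < +oo)%E.
    have mSn : measurable (S n : set (borelType G)) := mS n.
    apply: le_lt_trans foo; rewrite -integral_cst//.
    apply: (@le_trans _ _ (\int[mu]_(t in (S n : set (borelType G))) (F t)%:E)%E).
      apply: ge0_le_integral => //; first by move=> t _; rewrite lee_fin invr_ge0.
      by apply: measurable_funTS; apply/measurable_EFinP.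
    apply: ge0_subset_integral => //; first by apply/measurable_EFinP.
    by move=> x _; rewrite lee_fin powR_ge0.
  rewrite !ltey; apply: contra => /eqP ->.
  by rewrite gt0_muley// lte_fin invr_gt0.
- move=> t ft; have Ft : 0 < F t.
    by rewrite powR_gt0// mulr_gt0 ?hw.2// lt_def ft f0.
  exists (Num.truncn (F t)^-1); rewrite /S /= invf_ple ?posrE//.
  by apply: ltW; exact: truncnS_gt.
Qed.

(** The [t] with [t^-1 s] in [Z] could matter only where [f] does not vanish, and
    there they form a null set by [null_invmulg]. *)
Lemma conv_outside_null f g g' Z s : Lpos f -> borel_rfun g -> borel_rfun g' ->
  (forall x, 0 <= g x) -> (forall x, 0 <= g' x) -> borel Z -> mu Z = 0%E ->
  (forall x, ~ Z x -> g x <= g' x) -> (conv f g s <= conv f g' s)%E.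
Proof.
move=> Lf mg mg' g0 g'0 mZ Z0 gg'; have [mf f0 _] := Lf.
have [S [mS Soo fS]] := lpos_support Lf.
pose N := \bigcup_n (S n `&` [set t | Z (t^-1 * s)%g]).
have mSZ n : borel (S n `&` [set t | Z (t^-1 * s)%g]).
  by apply: borelI => //; apply: borel_preimage => //; exact: continuous_invmulg.
have mN : borel N by exact: bigcupT_measurable.
have N0 : mu N = 0%E.
  apply/eqP; rewrite -measure_le0.
  apply: le_trans (measure_sigma_subadditive mu mSZ mN (@subset_refl _ _)) _.
  by rewrite eseries0// => n _ _; exact: null_invmulg.
apply: ae_ge0_le_integral => //.
- by move=> t _; rewrite lee_fin mulr_ge0.
- exact: borel_conv.
- by move=> t _; rewrite lee_fin mulr_ge0.
- exact: borel_conv.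
apply: (haar_ae_outside mN N0) => t nN _; rewrite lee_fin.
have [->|ft] := eqVneq (f t) 0; first by rewrite !mul0r.
rewrite ler_wpM2l//; apply: gg' => Zt; apply: nN.
by have [n Sn] := fS _ ft; exists n.
Qed.

(** Gliding hump: were no constant to work, suitably scaled counterexamples
    would lie below one function of finite norm whose convolution with [f] has
    infinite norm.  Positivity makes the argument possible: the convolution of the
    upper bound dominates that of each counterexample. *)
Lemma conv_bounded f : Lpos f -> exists2 C : R, 0 <= C &
  forall g k, Lpos g -> Lpos k -> (\forall s \ae mu, conv f g s = (k s)%:E) ->
    (lpw_norm k <= C%:E * lpw_norm g)%E.
Proof.
move=> Lf; apply: contrapT => nC; have [mf f0 _] := Lf.
have bad (n : nat) : exists gk : (G -> R) * (G -> R), [/\ Lpos gk.1, Lpos gk.2,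
    \forall s \ae mu, conv f gk.1 s = (gk.2 s)%:E &
    ((n%:R * 2 ^+ n.+1)%:E * lpw_norm gk.1 < lpw_norm gk.2)%E].
  apply: contrapT => nb; apply: nC; exists (n%:R * 2 ^+ n.+1).
    by rewrite mulr_ge0 ?exprn_ge0.
  move=> g k Lg Lk gk; rewrite leNgt; apply/negP => lt_.
  by apply: nb; exists (g, k); split; [exact: Lg|exact: Lk|exact: gk|exact: lt_].
have [gk gkP] := choice bad.
pose g n := (gk n).1; pose k n := (gk n).2.
have fin u : Lpos u -> lpw_norm u = (fine (lpw_norm u))%:E.
  by move=> [_ _ uoo]; rewrite fineK// ge0_fin_numE// lpw_norm_ge0.
pose b n := fine (lpw_norm (g n)); pose c n := fine (lpw_norm (k n)).
have bE n : lpw_norm (g n) = (b n)%:E by have [Lg _ _ _] := gkP n; exact: fin.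
have cE n : lpw_norm (k n) = (c n)%:E by have [_ Lk _ _] := gkP n; exact: fin.
have b0 n : 0 <= b n by rewrite -lee_fin -bE lpw_norm_ge0.
have bc n : n%:R * 2 ^+ n.+1 * b n < c n.
  by have [_ _ _] := gkP n; rewrite -/(g n) -/(k n) bE cE -EFinM lte_fin.
have c0 n : 0 < c n by apply: le_lt_trans (bc n); rewrite !mulr_ge0 ?exprn_ge0.
clearbody b c.
(* [l n * k n] has norm [n], while the norms of [l n * g n] are summable. *)
pose l n := (n%:R / c n) `^ p^-1.
have l0 n : 0 <= l n by exact: powR_ge0.
have lp n : l n `^ p = n%:R / c n.
  rewrite /l -powRrM mulVf ?gt_eqF// powRr1// divr_ge0// ltW//.
have [] := summable_dominated (mu := mu) hw p1 (F := fun n x => l n * g n x).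
- move=> n; have [[mg _ _] _ _ _] := gkP n.
  by apply: measurable_funM => //; exact: measurable_cst.
- by move=> n x; have [[_ g0 _] _ _ _] := gkP n; apply: mulr_ge0 (l0 n) (g0 x).
- apply: (@le_lt_trans _ _ 1%:E); last exact: ltry.
  apply: le_trans (@epsilon_trick0 R 1 xpredT _) => //.
  apply: lee_nneseries => n *; first exact: lpw_norm_ge0.
  have [[mg g0 _] _ _ _] := gkP n.
  rewrite lpw_normZ// -/(g n) lp bE -EFinM lee_fin mul1r natrX.
  rewrite mulrAC ler_pdivrMr// ler_pdivlMl ?exprn_gt0// ltW//.
  by rewrite mulrA [_ * n%:R]mulrC.
move=> h [Z [Lh mZ Z0 hZ]].
have [k' Lk' k'E] := algebra_conv hw p1 alg Lf Lh.
have big (n : nat) : (n%:R%:E <= lpw_norm k')%E.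
  have [[mg g0 goo] [mk k0 _] gkE _] := gkP n.
  rewrite -/(g n) -/(k n) in mg g0 goo mk k0 gkE.
  have [mk' k'0 _] := Lk'; have [mh h0 _] := Lh.
  rewrite (_ : n%:R%:E = lpw_norm (fun x => l n * k n x)); last first.
    by rewrite lpw_normZ// lp cE -EFinM divfK// gt_eqF.
  apply: le_lpw_norm => //.
  - by apply: measurable_funM => //; exact: measurable_cst.
  - by move=> x; rewrite mulr_ge0.
  apply: haar_ae_imply2 k'E gkE => s k's ks.
  rewrite -lee_fin -k's EFinM -ks /conv -ge0_integralZl_EFin//; last 2 first.
  - by move=> t _; rewrite lee_fin mulr_ge0.
  - exact: borel_conv.
  apply: le_trans (conv_outside_null (g := fun x => l n * g n x) s Lf _ mh _ h0 mZ Z0 _).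
  - rewrite le_eqVlt; apply/orP; left; apply/eqP; apply: eq_integral => t _.
    by rewrite -EFinM mulrCA.
  - by apply: measurable_funM => //; exact: measurable_cst.
  - by move=> x; rewrite mulr_ge0.
  - by move=> x; exact: hZ.
have [_ _] := Lk'; rewrite (fin _ Lk').
have := big (Num.truncn (fine (lpw_norm k'))).+1; rewrite (fin _ Lk') lee_fin.
by move=> /(lt_le_trans (truncnS_gt _)); rewrite ltxx.
Qed.

End ConvolutionBound.

(** * Indicators of finite norm *)

Section UnitNeighbourhood.
Context {R : realType} {G : topologicalGroupType}.
Context {mu : {measure set (borelType G) -> \bar R}}.
Hypotheses (hG : locally_compact_group G) (hmu : left_haar mu).
Context {w : G -> R} {p : R}.
Hypotheses (hw : weight w) (p1 : 1 < p) (alg : Lpw_algebra mu p w).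
Implicit Types (A B K S T Z : set G) (x s t : G) (f g k : G -> R).

Local Notation lpw_norm := (lpw_norm (mu := mu) (w := w) (p := p)).
Local Notation Lpos := (Lpos (mu := mu) (w := w) (p := p)).
Local Notation conv := (conv (mu := mu)).

Let p0 : 0 < p. Proof. exact: lt_trans p1. Qed.

Let ww x : 0 <= w x. Proof. by apply: ltW; exact: hw.2. Qed.

Lemma borel_rfun_indic S : borel S -> borel_rfun (\1_S : G -> R).
Proof. exact: measurable_indic. Qed.

Lemma lpw_norm_indic_le S (M : R) : borel S -> 0 <= M -> (forall t, S t -> w t <= M) ->
  (lpw_norm \1_S <= (M `^ p)%:E * mu S)%E.
Proof.
move=> mS M0 SM.
have mS' : measurable (S : set (borelType G)) := mS.
rewrite -(integral_cst mu mS') [leRHS]integral_mkcond.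
apply: ge0_le_integral => //.
- by move=> t _; rewrite lee_fin powR_ge0.
- by apply/measurable_EFinP; apply: borel_lpw => //; exact: borel_rfun_indic.
- by apply/(measurable_restrictT _ _).1 => //; exact: measurable_cst.
move=> t _; rewrite patchE indicE; case: ifPn => [/set_mem St|nS].
  rewrite mul1r lee_fin; apply: ge0_ler_powR; rewrite ?nnegrE//; first exact: ltW.
  exact: SM.
by rewrite mul0r powR0// gt_eqF.
Qed.

Lemma lpos_indic S (M : R) : borel S -> (mu S < +oo)%E -> 0 <= M ->
  (forall t, S t -> w t <= M) -> Lpos \1_S.
Proof.
move=> mS Soo M0 SM; split; first exact: borel_rfun_indic.
  by move=> x; rewrite indicE.
apply: le_lt_trans (lpw_norm_indic_le mS M0 SM) _.
by rewrite lte_mul_pinfty// lee_fin powR_ge0.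
Qed.

Lemma borel_sublevel (c : R) : borel [set t | w t <= c].
Proof.
rewrite (_ : [set t | _] = w @^-1` `]-oo, c]%classic).
  by have := hw.1 measurableT _ (measurable_itv `]-oo, c]); rewrite setTI.
by apply/seteqP; split => t /=; rewrite in_itv.
Qed.

Lemma borel_sublevel_inv (c : R) : borel [set t | w t^-1%g <= c].
Proof. exact: (borel_preimage (@invg_continuous G) (borel_sublevel c)). Qed.

(** The weight is not assumed locally bounded, so it is not clear at first
    that any neighbourhood of the unit has an indicator of finite norm.  The
    convolution of the indicators of [K] and [K^-1], where [w] is bounded on
    both, is bounded below near the unit. *)
Lemma finite_norm_nbhs1 : exists V, [/\ open V, V 1%g, (mu V < +oo)%E & Lpos \1_V].
Proof.
have [Q [cQ Q1 _ _]] := compact_symmetric_nbhs1 hG (@filterT _ (nbhs (1%g : G)) _).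
have mQ := compact_borel hG.1 cQ.
have Q0 := haar_nbhs_gt0 hG hmu mQ Q1.
pose A (n : nat) := Q `&` ([set t | w t <= n%:R] `&` [set t | w t^-1%g <= n%:R]).
have mA n : borel (A n).
  by apply: borelI => //; apply: borelI; [exact: borel_sublevel|exact: borel_sublevel_inv].
have [n An0] : exists n, (0 < mu (A n))%E.
  apply: contrapT => nA; move: Q0; rewrite ltNge => /negP; apply.
  apply: le_trans (measure_sigma_subadditive mu mA mQ _) _.
    move=> t Qt; pose m := maxn (Num.truncn (w t)).+1 (Num.truncn (w t^-1%g)).+1.
    exists m => //; split => //; split => /=.
      apply: ltW; apply: lt_le_trans (truncnS_gt _) _.
      by rewrite ler_nat leq_maxl.
    apply: ltW; apply: lt_le_trans (truncnS_gt _) _.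
    by rewrite ler_nat leq_maxr.
  rewrite eseries0// => n _ _; apply/eqP; rewrite -measure_le0 leNgt; apply/negP => A0.
  by apply: nA; exists n.
have [|K [cK KA K0]] := haar_inner_compact hG hmu (mA n) _ An0.
  by apply: le_lt_trans (haar_compact hmu cQ); apply: haar_le => // t [].
have mK := compact_borel hG.1 cK.
pose K' := [set t | K t^-1%g].
have cK' : compact K' by exact: compact_invset.
have mK' := compact_borel hG.1 cK'.
have LK : Lpos \1_K.
  by apply: (@lpos_indic _ n%:R) => //; [exact: haar_compact|move=> t /KA[_ []]].
have LK' : Lpos \1_K'.
  apply: (@lpos_indic _ n%:R) => //; first exact: haar_compact.
  by move=> t /KA[_ [_]] /=; rewrite invgK.
have [k Lk kE] := algebra_conv hw p1 alg LK LK'.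
have convE s : conv \1_K \1_K' s = mu (K `&` ltrans s K).
  rewrite -(setIT (K `&` _)) -integral_indic//; last by apply: borelI => //; exact: borel_ltrans.
  apply: eq_integral => t _; congr EFin; rewrite setIC /= !indicE in_setI mulrC.
  rewrite (_ : (t^-1 * s)%g \in K' = (t \in ltrans s K)) ?natrM; last first.
    by rewrite /K' /ltrans; apply/idP/idP; rewrite !inE /= invgM invgK.
  by case: (_ \in _); case: (_ \in _); rewrite ?mul0r ?mulr0 ?mulr1.
pose c := fine (mu K) / 2.
have KE : mu K = (fine (mu K))%:E by rewrite fineK// (haar_fin hmu).
have fK0 : 0 < fine (mu K) by rewrite -lte_fin -KE.
have c0 : 0 < c by rewrite divr_gt0.
have cK2 : (c%:E < mu K)%E by rewrite KE lte_fin /c ltr_pdivrMr// mulr2n mulrDr mulr1 ltrDl.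
have W1 := haar_ltransI hG hmu cK cK2.
pose V : set G := interior ([set u | (c%:E < mu (K `&` ltrans u K))%E] `&` Q).
have oV : open V by exact: open_interior.
have mV := open_borel oV.
have V1 : V 1%g by rewrite /V /interior; exact: filterI.
have VQ : V `<=` Q by move=> t /interior_subset[].
exists V; split; [exact: oV|exact: V1| |].
  by apply: le_lt_trans (haar_compact hmu cQ); exact: haar_le.
have mV' : borel_rfun (\1_V : G -> R) by exact: borel_rfun_indic.
split; [exact: mV'|by move=> x; rewrite indicE|].
have [mk k0 koo] := Lk.
have : ((c `^ p)%:E * lpw_norm \1_V < +oo)%E.
  apply: le_lt_trans koo.
  have i0 x : 0 <= (\1_V : G -> R) x by rewrite indicE.
  rewrite -(lpw_normZ hw mV' i0 (ltW c0)).
  apply: le_lpw_norm => //.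
  - by apply: measurable_funM => //; exact: measurable_cst.
  - by move=> x; rewrite indicE mulr_ge0// ltW.
  apply: haar_ae_imply kE => s; rewrite convE => ks.
  rewrite indicE; have [/set_mem Vs|_] := boolP (s \in V); last by rewrite mulr0.
  rewrite mulr1 -lee_fin -ks; apply: ltW.
  by have /interior_subset[] := Vs.
rewrite !ltey; apply: contra => /eqP ->.
by rewrite gt0_muley// lte_fin powR_gt0.
Qed.

(** Continuity of the measure along the increasing sublevel sets of [w]. *)
Lemma sublevel_translates K (d : R) : compact K -> (d%:E < mu K)%E ->
  forall x, exists n : nat, forall m, (n <= m)%N ->
    (d%:E <= mu (ltrans x K `&` [set r | (w r <= m%:R)%R]))%E.
Proof.
move=> cK dK x; have mK := compact_borel hG.1 cK.
pose F (m : nat) := ltrans x K `&` [set r | w r <= m%:R].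
have mF m : borel (F m) by apply: borelI; [exact: borel_ltrans|exact: borel_sublevel].
have UF : \bigcup_m F m = ltrans x K.
  apply/seteqP; split=> [t [m _ []]//|t Kt].
  exists (Num.truncn (w t)).+1 => //; split => //=; apply: ltW; exact: truncnS_gt.
have ndF : {homo F : n m / (n <= m)%N >-> (n <= m)%O}.
  move=> n m nm; apply/subsetPset => t [Kt wt]; split => //=.
  by apply: le_trans wt _; rewrite ler_nat.
have mUF : borel (\bigcup_m F m) by rewrite UF; exact: borel_ltrans.
have := nondecreasing_cvg_mu (mu := mu) mF mUF ndF.
rewrite UF (haar_ltrans hmu)// => cvF.
have [n _ nF] := cvF _ (open_ereal_gt' dK).
by exists n => m nm; apply: ltW; exact: nF.
Qed.

End UnitNeighbourhood.

(** * Superharmonic functions *)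

(** The convolution by [b (1_A + 1_B) + 1_V]. *)
Definition conv3 (R : realType) (G : topologicalGroupType)
    (mu : {measure set (borelType G) -> \bar R}) (b : R) (A B V : set G)
    (g : G -> \bar R) (s : G) : \bar R :=
  (b%:E * setconv mu A g s + b%:E * setconv mu B g s + setconv mu V g s)%E.

Section Superharmonic.
Context {R : realType} {G : topologicalGroupType}.
Context {mu : {measure set (borelType G) -> \bar R}}.
Hypotheses (hG : locally_compact_group G) (hmu : left_haar mu).
Context {w : G -> R} {p : R}.
Hypotheses (hw : weight w) (p1 : 1 < p) (alg : Lpw_algebra mu p w).
Implicit Types (A B K S T V Z : set G) (x s t : G) (f g k : G -> R).

Local Notation lpw_norm := (lpw_norm (mu := mu) (w := w) (p := p)).
Local Notation Lpos := (Lpos (mu := mu) (w := w) (p := p)).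
Local Notation conv := (conv (mu := mu)).

Let p0 : 0 < p. Proof. exact: lt_trans p1. Qed.

Let ww x : 0 <= w x. Proof. by apply: ltW; exact: hw.2. Qed.

Definition bounded_Lpos g := Lpos g /\ exists M, forall x, g x <= M.

Lemma bounded_LposD f g : bounded_Lpos f -> bounded_Lpos g ->
  bounded_Lpos (fun x => f x + g x) /\
  (lpw_norm (fun x => f x + g x)%R <= (2 `^ p)%:E * (lpw_norm f + lpw_norm g))%E.
Proof.
move=> [[mf f0 foo] [M fM]] [[mg g0 goo] [M' gM']].
have mfg : borel_rfun (fun x => f x + g x) by exact: measurable_funD.
have le : (lpw_norm (fun x => f x + g x)%R <= (2 `^ p)%:E * (lpw_norm f + lpw_norm g))%E.
  have mJ u : borel_rfun u -> borel_fun (fun x => ((u x * w x) `^ p)%:E).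
    by move=> mu'; apply/measurable_EFinP; exact: borel_lpw.
  rewrite -ge0_integralD//; last 4 first.
  - by move=> x _; rewrite lee_fin powR_ge0.
  - exact: mJ.
  - by move=> x _; rewrite lee_fin powR_ge0.
  - exact: mJ.
  rewrite -ge0_integralZl_EFin ?powR_ge0//; last 2 first.
  - by move=> x _; rewrite adde_ge0// lee_fin powR_ge0.
  - by apply: emeasurable_funD; exact: mJ.
  apply: ge0_le_integral => //.
  - by move=> x _; rewrite lee_fin powR_ge0.
  - exact: mJ.
  - by apply: measurable_funeM; apply: emeasurable_funD; exact: mJ.
  move=> x _; rewrite -EFinD -EFinM lee_fin.
  have a0 : 0 <= f x * w x by rewrite mulr_ge0.
  have b0 : 0 <= g x * w x by rewrite mulr_ge0.
  rewrite mulrDl; set a := f x * w x in a0 *; set b := g x * w x in b0 *.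
  have mx : Num.max a b `^ p <= a `^ p + b `^ p.
    by rewrite /Num.max; case: ifPn => _; rewrite ?lerDl ?lerDr powR_ge0.
  have m0 : 0 <= Num.max a b by rewrite le_max a0.
  apply: (@le_trans _ _ ((2 * Num.max a b) `^ p)).
    apply: ge0_ler_powR; rewrite ?nnegrE ?addr_ge0 ?mulr_ge0//; first exact: ltW.
    by rewrite mulr2n mulrDl !mul1r lerD// le_max lexx ?orbT.
  by rewrite powRM// ler_wpM2l// powR_ge0.
split; last exact: le.
split; last by exists (M + M') => x; exact: lerD.
split; [exact: mfg|by move=> x; exact: addr_ge0|].
apply: le_lt_trans le (lte_mul_pinfty _ _ _); first by rewrite lee_fin powR_ge0.
  by [].
exact: lte_add_pinfty foo goo.
Qed.

Definition rsetconv (a : R) S g s := fine (a%:E * setconv mu S (fun x => (g x)%:E) s)%E.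

Lemma rsetconvE a S g s : 0 <= a -> borel S -> (mu S < +oo)%E -> bounded_Lpos g ->
  (rsetconv a S g s)%:E = (a%:E * setconv mu S (fun x => (g x)%:E) s)%E.
Proof.
move=> a0 mS Soo [[mg g0 _] [M gM]].
have M0 : 0 <= M by exact: le_trans (gM 1%g).
rewrite /rsetconv fineK// fin_numM// ge0_fin_numE; last first.
  by apply: setconv_ge0 => x; rewrite lee_fin.
apply: (@le_lt_trans _ _ (M%:E * mu S)%E); last first.
  by rewrite lte_mul_pinfty.
apply: setconv_le_cst => //; first by apply/measurable_EFinP.
by move=> x; rewrite lee_fin.
Qed.

(** Any function dominating [a] times the indicator of [S] transfers its
    constant to convolution by that indicator. *)
Lemma rsetconv_bounded f (C : R) a S g : Lpos f ->
  (forall g k, Lpos g -> Lpos k -> (\forall s \ae mu, conv f g s = (k s)%:E) ->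
    (lpw_norm k <= C%:E * lpw_norm g)%E) ->
  0 <= C -> 0 <= a -> borel S -> (mu S < +oo)%E -> (\forall x \ae mu, S x -> a <= f x) ->
  bounded_Lpos g -> bounded_Lpos (rsetconv a S g) /\ (lpw_norm (rsetconv a S g) <= C%:E * lpw_norm g)%E.
Proof.
move=> Lf bC C0 a0 mS Soo af bg; have [Lg [M gM]] := bg.
have [mf f0 _] := Lf; have [mg g0 goo] := Lg.
have M0 : 0 <= M by exact: le_trans (gM 1%g).
have mS' : measurable (S : set (borelType G)) := mS.
have mgE : borel_fun (fun x => (g x)%:E) by apply/measurable_EFinP.
have gE0 x : (0 <= (g x)%:E)%E by rewrite lee_fin.
have st0 s : 0 <= rsetconv a S g s.
  by rewrite -lee_fin rsetconvE// mule_ge0// setconv_ge0.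
have mst : borel_rfun (rsetconv a S g).
  apply: (measurableT_comp (fine_measurable _)) => //.
  by apply: measurable_funeM; exact: borel_fun_setconv.
have [k Lk kE] := algebra_conv hw p1 alg Lf Lg.
have stk : \forall s \ae mu, rsetconv a S g s <= k s.
  apply: haar_ae_imply kE => s ks; rewrite -lee_fin -ks rsetconvE// /setconv.
  have mG : measurable_fun (S : set (borelType G)) (fun t : borelType G => (g (t^-1 * s)%g)%:E).
    by apply: measurable_funTS; exact: (borel_fun_invmulg s mgE).
  rewrite -ge0_integralZl_EFin//.
  apply: (@le_trans _ _ (\int[mu]_(t in (S : set (borelType G))) (f t * g (t^-1 * s)%g)%:E)%E).
    apply: ae_ge0_le_integral => //.
    - by move=> t _; rewrite mule_ge0.
    - exact: measurable_funeM.
    - by move=> t _; rewrite lee_fin mulr_ge0.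
    - by apply: measurable_funTS; exact: borel_conv.
    by apply: haar_ae_imply af => t aft /aft{}aft; rewrite -EFinM lee_fin ler_wpM2r.
  apply: ge0_subset_integral => //; first exact: borel_conv.
  by move=> t _; rewrite lee_fin mulr_ge0.
have [mk k0 koo] := Lk.
have le : (lpw_norm (rsetconv a S g) <= C%:E * lpw_norm g)%E.
  by apply: le_trans (bC _ _ Lg Lk kE); exact: le_lpw_norm.
split; last exact: le.
split.
  split; [exact: mst|exact: st0|].
  by apply: le_lt_trans le (lte_mul_pinfty _ _ goo); first by rewrite lee_fin.
exists (a * (M * fine (mu S))) => s; rewrite -lee_fin rsetconvE// EFinM EFinM fineK ?ge0_fin_numE//.
rewrite lee_wpmul2l//; apply: setconv_le_cst => // t _.
by rewrite lee_fin.
Qed.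

Lemma setconv_nneseries S (F : nat -> G -> \bar R) s : borel S ->
  (forall n, borel_fun (F n)) -> (forall n x, 0 <= F n x)%E ->
  setconv mu S (fun x => \sum_(n <oo) F n x)%E s = (\sum_(n <oo) setconv mu S (F n) s)%E.
Proof.
move=> mS mF F0; rewrite /setconv integral_nneseries//.
by move=> n; apply: measurable_funTS; exact: (borel_fun_invmulg s (mF n)).
Qed.

Lemma conv3_nneseries b A B V (F : nat -> G -> \bar R) s : 0 <= b ->
  borel A -> borel B -> borel V ->
  (forall n, borel_fun (F n)) -> (forall n x, 0 <= F n x)%E ->
  conv3 mu b A B V (fun x => \sum_(n <oo) F n x)%E s =
  (\sum_(n <oo) conv3 mu b A B V (F n) s)%E.
Proof.
move=> b0 mA mB mV mF F0; rewrite /conv3 !setconv_nneseries//.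
have h0 S n : (0 <= setconv mu S (F n) s)%E by exact: setconv_ge0.
rewrite -!nneseriesZl// -!nneseriesD//.
- by move=> n _ _; rewrite adde_ge0// mule_ge0.
- by move=> n _ _; rewrite mule_ge0.
- by move=> n _ _; rewrite mule_ge0.
Qed.

Lemma conv3Z b A B V (c : R) (g : G -> \bar R) s : 0 <= c -> 0 <= b ->
  borel A -> borel B -> borel V -> borel_fun g -> (forall x, 0 <= g x)%E ->
  conv3 mu b A B V (fun x => c%:E * g x)%E s = (c%:E * conv3 mu b A B V g s)%E.
Proof.
move=> c0 b0 mA mB mV mg g0.
have E S : borel S -> setconv mu S (fun x => c%:E * g x)%E s = (c%:E * setconv mu S g s)%E.
  move=> mS; rewrite /setconv ge0_integralZl_EFin//.
  by apply: measurable_funTS; exact: (borel_fun_invmulg s mg).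
have h0 S : (0 <= setconv mu S g s)%E by exact: setconv_ge0.
rewrite /conv3 !E//; move: (h0 A) (h0 B) (h0 V).
move: (setconv mu A g s) (setconv mu B g s) (setconv mu V g s) => x y z x0 y0 z0.
by rewrite !ge0_muleDr ?adde_ge0 ?mule_ge0 ?lee_fin// !(muleCA b%:E).
Qed.

(** A Neumann series: [g = \sum_n th ^ n * T ^ n g0] satisfies [T g <= th^-1 g]
    at every point, and for [th] small enough in terms of [C] it converges almost
    everywhere because the norms of [(2 th) ^ n * T ^ n g0] are summable.  That
    [kappa] depends on [C] alone, not on [A], [B] and [b], is essential later. *)
Lemma superharmonic_exists (C : R) : 0 < C ->
  exists2 kappa : R, 0 < kappa & forall b A B V g0, 0 <= b ->
    borel A -> borel B -> borel V ->
    (mu A < +oo)%E -> (mu B < +oo)%E -> (mu V < +oo)%E ->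
    (forall g, bounded_Lpos g ->
      let Tg := fun s => rsetconv b A g s + rsetconv b B g s + rsetconv 1 V g s in
      bounded_Lpos Tg /\ (lpw_norm Tg <= C%:E * lpw_norm g)%E) ->
    bounded_Lpos g0 ->
    exists g : G -> \bar R, [/\ borel_fun g, forall x, (0 <= g x)%E,
      exists Z, [/\ borel Z, mu Z = 0%E & forall x, ~ Z x -> (g x < +oo)%E],
      forall x, ((g0 x)%:E <= g x)%E &
      forall s, (conv3 mu b A B V g s <= kappa%:E * g s)%E].
Proof.
move=> C0.
pose l := (2 * C)^-1 `^ p^-1.
have C2 : 0 < 2 * C by rewrite mulr_gt0.
have l0 : 0 < l by rewrite powR_gt0// invr_gt0.
have lp : l `^ p = (2 * C)^-1.
  by rewrite /l -powRrM mulVf ?gt_eqF// powRr1// invr_ge0 ltW.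
pose th := l / 2; have th0 : 0 < th by rewrite divr_gt0.
exists th^-1; first by rewrite invr_gt0.
move=> b A B V g0 b0 mA mB mV Aoo Boo Voo TP bg0.
pose T g s := rsetconv b A g s + rsetconv b B g s + rsetconv 1 V g s.
pose u n := iter n T g0.
have bu n : bounded_Lpos (u n) by elim: n => //= n IH; exact: (TP _ IH).1.
have Lu n : Lpos (u n) by exact: (bu n).1.
have mu_ n : borel_rfun (u n) by have [] := Lu n.
have u0 n x : 0 <= u n x by have [] := Lu n.
have nu n : (lpw_norm (u n) <= (C ^+ n)%:E * lpw_norm g0)%E.
  elim: n => [|n IH]; first by rewrite expr0 mul1e.
  apply: le_trans (TP _ (bu n)).2 _.
  by rewrite exprS EFinM -muleA lee_wpmul2l// lee_fin ltW.
pose F n x := l ^+ n * u n x.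
have g0fin : lpw_norm g0 = (fine (lpw_norm g0))%:E.
  by rewrite fineK// ge0_fin_numE ?lpw_norm_ge0//; have [] := Lu 0%N.
have [] := summable_dominated (mu := mu) hw p1 (F := F).
- move=> n; apply: (measurable_funM (f := fun=> l ^+ n)) => //.
  exact: mu_.
- by move=> n x; rewrite mulr_ge0// exprn_ge0// ltW.
- apply: (@le_lt_trans _ _ (2 * fine (lpw_norm g0))%:E); last exact: ltry.
  have J0 : 0 <= 2 * fine (lpw_norm g0) by rewrite mulr_ge0 ?fine_ge0 ?lpw_norm_ge0.
  apply: le_trans (@epsilon_trick0 R _ xpredT J0).
  apply: lee_nneseries => n *; first exact: lpw_norm_ge0.
  have -> : lpw_norm (F n) = (((l ^+ n) `^ p)%:E * lpw_norm (u n))%E.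
    by apply: lpw_normZ => //; rewrite exprn_ge0// ltW.
  apply: (@le_trans _ _ (((l ^+ n) `^ p)%:E * ((C ^+ n)%:E * lpw_norm g0))%E).
    by rewrite lee_wpmul2l// lee_fin powR_ge0.
  have -> : (l ^+ n) `^ p = (2 * C)^-1 ^+ n.
    rewrite -powR_mulrn ?(ltW l0)// -powRrM mulrC powRrM lp.
    by rewrite powR_mulrn// invr_ge0 ltW.
  rewrite g0fin -!EFinM lee_fin natrX exprS le_eqVlt; apply/orP; left; apply/eqP.
  rewrite exprVn exprMn; field.
  by rewrite !expf_neq0 ?gt_eqF.
move=> h [Z [Lh mZ Z0 hZ]].
pose g x : \bar R := (\sum_(n <oo) (th ^+ n)%:E * (u n x)%:E)%E.
have mF n : borel_fun (fun x => ((th ^+ n)%:E * (u n x)%:E)%E).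
  by apply: measurable_funeM; apply/measurable_EFinP; exact: mu_.
have F0 n x : (0 <= (th ^+ n)%:E * (u n x)%:E)%E.
  by rewrite mule_ge0// lee_fin// exprn_ge0// ltW.
have gge0 x : (0 <= g x)%E by exact: nneseries_ge0.
exists g; split => //.
- by apply: ge0_emeasurable_sum => [n x _ _|n _]; [exact: F0|exact: mF].
- exists Z; split => // x nZ.
  have [_ h0 _] := Lh.
  apply: (@le_lt_trans _ _ (2 * h x)%:E); last exact: ltry.
  have H0 : 0 <= 2 * h x by rewrite mulr_ge0.
  apply: le_trans (@epsilon_trick0 R _ xpredT H0).
  apply: lee_nneseries => n *; first exact: F0.
  rewrite -EFinM lee_fin; have := hZ n x nZ; rewrite /F /th.
  rewrite expr_div_n natrX exprS => Fh.
  have e2 : 0 < 2 ^+ n :> R by rewrite exprn_gt0.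
  rewrite (_ : 2 * h x / _ = h x / 2 ^+ n); last by field; rewrite gt_eqF.
  by rewrite mulrAC ler_wpM2r// invr_ge0 ltW.
- move=> x; rewrite /g; apply: le_trans (nneseries_lim_ge 1 _); last by move=> *; exact: F0.
  by rewrite big_nat1 expr0 mul1e.
move=> s; rewrite conv3_nneseries//.
rewrite (_ : (fun _ => _) = fun n => \sum_(0 <= i < n) (th^-1%:E * ((th ^+ i.+1)%:E * (u i.+1 s)%:E)))%E.
  have F1 i : (0 <= (th ^+ i.+1)%:E * (u i.+1 s)%:E)%E by exact: F0.
  rewrite nneseriesZl// lee_wpmul2l ?lee_fin ?invr_ge0 ?(ltW th0)//.
  pose X i := ((th ^+ i)%:E * (u i s)%:E)%E.
  have -> : (\sum_(i <oo) (th ^+ i.+1)%:E * (u i.+1 s)%:E = \sum_(1 <= i <oo) X i)%E.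
    rewrite -(nneseries_addn 1); last by move=> i; exact: F0.
    by apply: eq_eseriesr => i _; rewrite addn1.
  rewrite /g (nneseries_split 0 1); last by move=> i _; exact: F0.
  by rewrite big_nat1 leeDr// F0.
apply/funext => n; apply: eq_bigr => i _.
have [Lui _] := bu i.
rewrite conv3Z ?exprn_ge0 ?(ltW th0)//; last 2 first.
- by apply/measurable_EFinP; exact: mu_.
- by move=> x; rewrite lee_fin u0.
rewrite /= -/(u i) {1}/T !EFinD !rsetconvE// mul1e -/(conv3 mu b A B V _ s).
by rewrite muleA -EFinM exprS mulKf// gt_eqF.
Qed.

End Superharmonic.

(** * Means of logarithmic increments *)

Section RealMean.
Context {R : realType} {G : topologicalGroupType}.
Context {mu : {measure set (borelType G) -> \bar R}}.
Implicit Types (phi psi : G -> R) (x y s t : G).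

Definition bounded_borel phi := borel_rfun phi /\ exists c : R, forall x, `|phi x| <= c.

Lemma bounded_borel_cst (c : R) : bounded_borel (fun=> c).
Proof. by split; [exact: measurable_cst|exists `|c|]. Qed.

(** An invariant mean on bounded real functions, with positivity and
    normalization combined in [rmean_le]. *)
Record real_mean (M : (G -> R) -> R) : Prop := RealMean {
  rmean_linear : forall (a : R) phi psi, bounded_borel phi -> bounded_borel psi ->
    M (fun x => a * phi x + psi x) = a * M phi + M psi ;
  rmean_le : forall phi (c : R), bounded_borel phi -> (forall x, phi x <= c) -> M phi <= c ;
  rmean_invariant : forall y phi, bounded_borel phi ->
    M (fun x => phi (y * x)%g) = M phi
}.

Lemma amenable_real_mean : amenable mu -> exists M, real_mean M.
Proof.
move=> [m [mlin m0 m1 minv]].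
pose C phi x : R[i] := Complex (phi x) 0.
have LC phi : bounded_borel phi -> Linfty mu (C phi).
  move=> [mphi [c phic]]; split; first by split; [exact: mphi|exact: measurable_cst].
  by exists c; apply: aeW => x; rewrite normc_real.
pose M phi := complex.Re (m (C phi)).
have Mlin (a : R) phi psi : bounded_borel phi -> bounded_borel psi ->
    M (fun x => a * phi x + psi x) = a * M phi + M psi.
  move=> bphi bpsi; rewrite /M.
  have -> : C (fun x => a * phi x + psi x) = (fun x => Complex a 0 * C phi x + C psi x).
    by apply/funext => x; rewrite /C mul_complex_real; simpc.
  rewrite mlin; [|exact: LC|exact: LC].
  by case: (m (C phi)) => u v; case: (m (C psi)) => u' v'; simpc.
exists M; split => // [phi c bphi phic|y phi bphi].
- have bc : bounded_borel (fun=> c) by exact: bounded_borel_cst.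
  have b1 : bounded_borel (fun=> 1) by exact: bounded_borel_cst.
  have b0 : bounded_borel (fun=> 0) by exact: bounded_borel_cst.
  have M1 : M (fun=> 1) = 1 by rewrite /M (_ : C _ = fun=> 1) ?m1.
  have M0 : M (fun=> 0) = 0.
    have := Mlin (-1) _ _ b0 b0.
    rewrite (_ : (fun _ : G => -1 * 0 + 0 : R) = (fun=> 0)); last by apply/funext => x; rewrite mulr0 addr0.
    by move=> ->; rewrite mulN1r addNr.
  have Mc : M (fun=> c) = c.
    have := Mlin c _ _ b1 b0.
    by rewrite M1 M0 mulr1 addr0 => e; rewrite -[RHS]e; congr M; apply/funext => x; rewrite /= mulr1 addr0.
  have bd : bounded_borel (fun x => -1 * phi x + c).
    split; first by apply: measurable_funD => //; apply: measurable_funM => //; exact: bphi.1.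
    have [e phie] := bphi.2; exists (e + `|c|) => x.
    by rewrite mulN1r (le_trans (ler_normD _ _))// normrN lerD.
  have : 0 <= m (C (fun x => -1 * phi x + c)).
    apply: m0; first exact: LC.
    apply: aeW => x; rewrite lecE /= eqxx /= mulN1r addrC subr_ge0.
    exact: phic.
  rewrite lecE /= => /andP[_]; rewrite -/(M _) Mlin// Mc.
  by rewrite mulN1r addrC subr_ge0.
- have := minv y^-1%g _ (LC _ bphi); rewrite /M => <-.
  by rewrite invgK.
Qed.

(** Since [expR u >= 1 + u], the hypothesis bounds a sum of increments of [l].  An
    invariant mean annihilates the increments along [t i] and along [(t i)^-1]
    taken together, because translating the former by [(t i)^-1] gives minus the
    latter; the increments along the [r j] cost at most [d] each. *)
Lemma log_mean_bound (l : G -> R) n N (r t : nat -> G) (lam : nat -> R) (d Q : R) :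
  amenable mu -> borel_rfun l ->
  (forall i, (i < N)%N -> exists c, forall s, `|l (t i * s)%g - l s| <= c) ->
  (forall j s, (j < n)%N -> l s - d <= l (r j * s)%g) ->
  (forall j, 0 <= lam j) ->
  (forall s, \sum_(j < n) lam j * \sum_(i < N)
     (expR (l ((t i)^-1 * (r j * s))%g) + expR (l (t i * (r j * s))%g)) <= Q * expR (l s)) ->
  (2 * N)%:R * \sum_(j < n) lam j <= Q * expR d.
Proof.
move=> am ml tb rd lam0 lQ; have [M [Mlin Mle Minv]] := amenable_real_mean am.
pose phi i s := l (t i * s)%g - l s.
have bphi i : (i < N)%N -> bounded_borel (phi i).
  move=> iN; split; last exact: tb.
  apply: measurable_funB => //.
  exact: (borel_rfun_comp (@continuous_lmulg G (t i)) ml).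
have btr u y : bounded_borel u -> bounded_borel (fun s => u (y * s)%g).
  move=> [mu' [c uc]]; split; last by exists c => x.
  exact: (borel_rfun_comp (@continuous_lmulg G y) mu').
have b0 : bounded_borel (fun=> 0) by exact: bounded_borel_cst.
pose null psi := bounded_borel psi /\ M psi = 0.
have blin (a : R) u v : bounded_borel u -> bounded_borel v ->
    bounded_borel (fun x => a * u x + v x).
  move=> [mu' [c uc]] [mv [c' vc]]; split.
    by apply: measurable_funD => //; apply: measurable_funM => //; exact: measurable_cst.
  exists (`|a| * c + c') => x.
  by rewrite (le_trans (ler_normD _ _))// lerD// normrM ler_wpM2l.
have M0 : M (fun=> 0) = 0.
  have := Mlin (-1) _ _ b0 b0.
  rewrite (_ : (fun _ : G => -1 * 0 + 0 : R) = (fun=> 0)); last by apply/funext => x; rewrite mulr0 addr0.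
  by move=> ->; rewrite mulN1r addNr.
have nullL (a : R) u v : null u -> null v -> null (fun x => a * u x + v x).
  by move=> [bu u0] [bv v0]; split; [exact: blin|rewrite Mlin// u0 v0 mulr0 addr0].
have nullD u y z : bounded_borel u -> null (fun s => u (y * s)%g - u (z * s)%g).
  move=> bu; have e : (fun s => u (y * s)%g - u (z * s)%g) =
      (fun s => -1 * u (z * s)%g + u (y * s)%g).
    by apply/funext => s; rewrite mulN1r addrC.
  rewrite /null e; split; first by apply: blin; exact: btr.
  by rewrite Mlin ?Minv//; [rewrite mulN1r addNr|exact: btr|exact: btr].
have null_sum k (c : nat -> R) (u : nat -> G -> R) : (forall i, (i < k)%N -> null (u i)) ->
    null (fun s => \sum_(i < k) c i * u i s).
  elim: k => [|k IH] uk.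
    rewrite (_ : (fun _ => _) = fun=> 0); first by split.
    by apply/funext => s; rewrite big_ord0.
  rewrite (_ : (fun _ => _) = fun s => c k * u k s + \sum_(i < k) c i * u i s).
    by apply: nullL; [exact: uk|apply: IH => i ik; apply: uk; exact: ltnW].
  by apply/funext => s; rewrite big_ord_recr /= addrC.
pose Psi s := \sum_(j < n) lam j * \sum_(i < N) 1 *
   (phi i (r j * s)%g - phi i ((t i)^-1 * r j * s)%g).
have nPsi : null Psi.
  apply: (null_sum n lam (fun j s => \sum_(i < N) 1 * (phi i (r j * s)%g - phi i ((t i)^-1 * r j * s)%g))).
  move=> j jn; apply: (null_sum N (fun=> 1) (fun i s => phi i (r j * s)%g - phi i ((t i)^-1 * r j * s)%g)).
  by move=> i iN; apply: nullD; exact: bphi.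
suff : M Psi <= Q * expR d - (2 * N)%:R * \sum_(j < n) lam j.
  by rewrite nPsi.2 subr_ge0.
apply: Mle; first exact: nPsi.1.
move=> s; rewrite lerBrDr.
have -> : Q * expR d = Q * expR (l s) * expR (d - l s).
  by rewrite -mulrA -expRD [_ + (d - _)]addrC subrK.
apply: le_trans (ler_wpM2r (expR_ge0 _) (lQ s)).
rewrite /Psi mulr_sumr -big_split /= mulr_suml; apply: ler_sum => j _.
rewrite [_ * lam j]mulrC -mulrDr -mulrA; apply: ler_wpM2l => //.
have -> : (2 * N)%:R = \sum_(i < N) 2 :> R by rewrite sumr_const card_ord natrM mulr_natr.
rewrite -big_split /= mulr_suml; apply: ler_sum => i _.
rewrite mul1r mulrDl -!expRD.
have e1 := expR_ge1Dx (l ((t i)^-1 * (r j * s))%g + (d - l s)).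
have e2 := expR_ge1Dx (l (t i * (r j * s))%g + (d - l s)).
apply: le_trans (lerD e1 e2).
have := rd j s (ltn_ord j); rewrite /phi -[((t i)^-1 * r j * s)%g]mulgA mulVKg.
by rewrite mulr2n; lra.
Qed.

End RealMean.

(** * The Harnack inequality and its consequences *)

Section Harnack.
Context {R : realType} {G : topologicalGroupType}.
Context {mu : {measure set (borelType G) -> \bar R}}.
Hypotheses (hG : locally_compact_group G) (hmu : left_haar mu).
Context {K V : set G} {g : G -> \bar R} {kappa : R}.
Hypotheses (cK : compact K) (K1 : nbhs (1%g : G) K) (Kinv : forall x, K x -> K x^-1%g).
Hypothesis KKKV : forall x y z, K x -> K y -> K z -> V (x * y * z)%g.
Hypotheses (mV : borel V) (mg : borel_fun g).
Hypotheses (g0 : forall x, (0 <= g x)%E) (kappa0 : 0 < kappa).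
Hypothesis Vg : forall s, (setconv mu V g s <= kappa%:E * g s)%E.
Implicit Types (A B S T Z : set G) (x s t : G).
Local Open Scope ereal_scope.

Local Notation h := (setconv mu K g).

Let mK : borel K. Proof. exact: compact_borel hG.1 cK. Qed.

Let K_1 : K 1%g. Proof. exact: nbhs_singleton. Qed.

Definition measK : R := fine (mu K).

Lemma measKE : mu K = measK%:E.
Proof. by rewrite fineK// (haar_fin hmu). Qed.

Lemma measK_gt0 : (0 < measK)%R.
Proof. by have := haar_nbhs_gt0 hG hmu mK K1; rewrite measKE lte_fin. Qed.

Definition harnack_cst : R := (kappa / measK)%R.

Local Notation D := harnack_cst.

Lemma harnack_cst_gt0 : (0 < D)%R.
Proof. by rewrite divr_gt0// measK_gt0. Qed.

Lemma setconvK_ge0 s : 0 <= h s.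
Proof. exact: setconv_ge0. Qed.

Lemma setconvK_le s : h s <= kappa%:E * g s.
Proof.
apply: le_trans (Vg s); apply: setconvS => // t Kt.
by rewrite -[t]mul1g -[1%g]mul1g; apply: KKKV.
Qed.

(** The superharmonic function dominates its average over [V], hence over every
    translate of [K K] by an element of [K]; averaging once more over [K]
    compares the value of [h] at two points of [K s]. *)
Lemma harnack v s : K v -> h (v * s)%g <= D%:E * h s.
Proof.
move=> Kv; pose KK := prodset K K.
have mKK : borel KK by apply: (compact_borel hG.1); exact: compact_prodset.
have le1 : h (v * s)%g <= setconv mu KK g s.
  rewrite (setconv_mull hmu)//; apply: setconvS => //; first exact: borel_ltrans.
  move=> t; rewrite /ltrans /= invgK => Kvt.
  by rewrite -[t](mulKg v); apply: mem_prodset => //; exact: Kinv.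
have kg0 x : 0 <= kappa%:E * g x by rewrite mule_ge0// lee_fin ltW.
have mkg : borel_fun (fun x => kappa%:E * g x) by exact: measurable_funeM.
have le2 : setconv mu KK g s * mu K <= kappa%:E * h s.
  have -> : kappa%:E * h s = setconv mu K (fun x => kappa%:E * g x) s.
    rewrite /setconv ge0_integralZl_EFin// ?ltW//.
    by apply: measurable_funTS; exact: (borel_fun_invmulg s mg).
  apply: setconv_cst_le => //; first exact: setconv_ge0.
  move=> t Kt; apply: le_trans (Vg _); rewrite (setconv_mull hmu)//.
  apply: setconvS => //; first exact: borel_ltrans.
  move=> _ [[x y] /= [Kx Ky] <-]; rewrite /ltrans /= invgK mulgA.
  by apply: KKKV => //; exact: Kinv.
have : h (v * s)%g * mu K <= kappa%:E * h s.
  by apply: le_trans le2; rewrite lee_wpmul2r.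
rewrite measKE => le3.
have k0 := measK_gt0.
have : measK^-1%:E * (h (v * s)%g * measK%:E) <= measK^-1%:E * (kappa%:E * h s).
  by rewrite lee_wpmul2l// lee_fin invr_ge0 ltW.
rewrite [X in X <= _](_ : _ = h (v * s)%g); last first.
  by rewrite muleCA -EFinM mulVf ?mule1// gt_eqF.
by rewrite muleA -EFinM mulrC.
Qed.

(** For [r] in [A] the point [t^-1 s] lies in [K r^-1 s], so [h (t^-1 s)] is at
    most a constant times [g (r^-1 s)]. *)
Lemma setconv_translate_ge t A (delta : R) s : borel A -> A `<=` ltrans t K ->
  (0 <= delta)%R -> delta%:E <= mu A ->
  delta%:E * h (t^-1 * s)%g <= (kappa * D)%:E * setconv mu A g s.
Proof.
move=> mA At delta0 dA.
have D0 := harnack_cst_gt0.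
have kD : (0 <= kappa * D)%R by rewrite mulr_ge0 ?ltW.
have -> : (kappa * D)%:E * setconv mu A g s = setconv mu A (fun x => (kappa * D)%:E * g x) s.
  rewrite /setconv ge0_integralZl_EFin//.
  by apply: measurable_funTS; exact: (borel_fun_invmulg s mg).
apply: (@le_trans _ _ (h (t^-1 * s)%g * mu A)).
  by rewrite muleC lee_wpmul2l// setconvK_ge0.
apply: setconv_cst_le => //; first exact: measurable_funeM.
  exact: setconvK_ge0.
move=> r /At; rewrite /ltrans /= => Kr.
have -> : (t^-1 * s)%g = ((t^-1 * r) * (r^-1 * s))%g by rewrite -mulgA mulVKg.
apply: le_trans (harnack _ Kr) _.
rewrite /= (_ : (kappa * D)%:E = D%:E * kappa%:E) -?muleA; last by rewrite -EFinM mulrC.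
by rewrite lee_wpmul2l ?lee_fin ?(ltW D0)// setconvK_le.
Qed.

(** Some point of [K s] avoids the null set, and the Harnack inequality carries
    finiteness from there to [s]. *)
Lemma setconvK_fin Z s : borel Z -> mu Z = 0 -> (forall x, ~ Z x -> g x < +oo) ->
  h s < +oo.
Proof.
move=> mZ Z0 gZ.
have N0 := null_invmulg hG hmu s mZ Z0 mK (haar_compact hmu cK).
have [t [Kt nZ]] : exists t, K t /\ ~ Z (t^-1 * s)%g.
  apply: contrapT => nt; have := haar_nbhs_gt0 hG hmu mK K1.
  rewrite (_ : K = K `&` [set t | Z (t^-1 * s)%g]) ?N0 ?ltxx//.
  apply/seteqP; split => [t Kt|t []//]; split => //=; apply: contrapT => nZ.
  by apply: nt; exists t.
rewrite -[s](mulVKg t); apply: le_lt_trans (harnack _ Kt) _.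
apply: lte_mul_pinfty; rewrite ?lee_fin ?(ltW harnack_cst_gt0)//.
by apply: le_lt_trans (setconvK_le _) _; rewrite lte_mul_pinfty ?gZ// lee_fin ltW.
Qed.

Lemma setconvK_gt0 : (forall x, V x -> 1 <= g x) -> 0 < h 1%g.
Proof.
move=> gV; apply: lt_le_trans (haar_nbhs_gt0 hG hmu mK K1) _.
rewrite -[leLHS]mul1e; apply: setconv_cst_le => // t Kt.
apply: gV; rewrite mulg1 -[t^-1%g]mul1g -[1%g]mul1g.
by apply: KKKV => //; exact: Kinv.
Qed.

(** The elements along which [ln \o h] has bounded increments, as the
    application of a mean requires; they form a subgroup. *)
Definition tame : set G := [set x | exists2 c : R, (0 <= c)%R &
  forall s, h (x * s)%g <= c%:E * h s /\ h (x^-1 * s)%g <= c%:E * h s].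

Lemma tame_K x : K x -> tame x.
Proof.
move=> Kx; exists D; first exact/ltW/harnack_cst_gt0.
by move=> s; split; apply: harnack => //; exact: Kinv.
Qed.

Lemma tame_inv x : tame x -> tame x^-1%g.
Proof. by move=> [c c0 xc]; exists c => // s; rewrite invgK; have [] := xc s. Qed.

Lemma tame_mul x y : tame x -> tame y -> tame (x * y)%g.
Proof.
move=> [c c0 xc] [d d0 yd]; exists (c * d)%R; first exact: mulr_ge0.
move=> s; rewrite invgM -!mulgA; split.
  apply: le_trans (xc _).1 _; rewrite EFinM -muleA lee_wpmul2l//.
  exact: (yd _).1.
apply: le_trans (yd _).2 _; rewrite mulrC EFinM -muleA lee_wpmul2l//.
exact: (xc _).2.
Qed.

Lemma tame_gt0 x : 0 < h 1%g -> tame x -> 0 < h x.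
Proof.
move=> h1 [c c0 xc]; have := (xc x).2; rewrite mulVg => le1.
rewrite lt_def setconvK_ge0 andbT; apply/eqP => hx.
by move: h1; rewrite ltNge; move: le1; rewrite hx mule0 => ->.
Qed.

Section Translates.
Context {N : nat} {t : nat -> G} {A B : nat -> set G} {b delta : R}.
Hypotheses (b0 : (0 <= b)%R) (delta0 : (0 <= delta)%R).
Hypotheses (mA : forall i, borel (A i)) (mB : forall i, borel (B i)).
Hypotheses (tA : trivIset [set: nat] A) (tB : trivIset [set: nat] B).
Hypotheses (At : forall i, A i `<=` ltrans (t i) K)
  (Bt : forall i, B i `<=` ltrans (t i)^-1%g K).
Hypotheses (dA : forall i, delta%:E <= mu (A i)) (dB : forall i, delta%:E <= mu (B i)).
Hypothesis ABg : forall s, b%:E * setconv mu (\big[setU/set0]_(i < N) A i) g s +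
  b%:E * setconv mu (\big[setU/set0]_(i < N) B i) g s <= kappa%:E * g s.

Let hsum x : \bar R := \sum_(i < N) (h ((t i)^-1 * x)%g + h (t i * x)%g).

Let E : R := (D * (kappa * (kappa * D)))%R.

Lemma setconv_bigsetU (Y : nat -> set G) n s : (forall i, borel (Y i)) ->
  trivIset [set: nat] Y ->
  setconv mu (\big[setU/set0]_(i < n) Y i) g s = \sum_(i < n) setconv mu (Y i) g s.
Proof.
move=> mY tY; apply: (ge0_integral_bigsetU mu (F := fun i : 'I_n => Y i)) => //.
- by move=> i; exact: mY.
- exact: index_enum_uniq.
- by move=> i j _ _ ij; apply: val_inj; exact: (tY i j I I ij).
- by apply: measurable_funTS; exact: (borel_fun_invmulg s mg).
Qed.

Lemma translates_le s : (b * delta)%:E * hsum s <= (kappa * (kappa * D))%:E * g s.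
Proof.
have kD0 : (0 <= kappa * D)%R by rewrite mulr_ge0 ?ltW ?harnack_cst_gt0.
have hA : delta%:E * \sum_(i < N) h ((t i)^-1 * s)%g <=
    (kappa * D)%:E * setconv mu (\big[setU/set0]_(i < N) A i) g s.
  rewrite setconv_bigsetU// !ge0_sume_distrr; last 2 first.
  - by move=> i _; exact: setconv_ge0.
  - by move=> i _; exact: setconvK_ge0.
  by apply: lee_sum => i _; apply: setconv_translate_ge.
have hB : delta%:E * \sum_(i < N) h (t i * s)%g <=
    (kappa * D)%:E * setconv mu (\big[setU/set0]_(i < N) B i) g s.
  rewrite setconv_bigsetU// !ge0_sume_distrr; last 2 first.
  - by move=> i _; exact: setconv_ge0.
  - by move=> i _; exact: setconvK_ge0.
  apply: lee_sum => i _; rewrite -{1}[t i]invgK.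
  exact: setconv_translate_ge.
rewrite /hsum big_split /= EFinM -muleA ge0_muleDr; last 2 first.
- by apply: sume_ge0 => i _; exact: setconvK_ge0.
- by apply: sume_ge0 => i _; exact: setconvK_ge0.
apply: (@le_trans _ _ (b%:E * ((kappa * D)%:E * setconv mu (\big[setU/set0]_(i < N) A i) g s +
    (kappa * D)%:E * setconv mu (\big[setU/set0]_(i < N) B i) g s))).
  by rewrite lee_wpmul2l// leeD.
rewrite -ge0_muleDr ?setconv_ge0// muleCA ge0_muleDr ?setconv_ge0//.
rewrite (_ : (kappa * (kappa * D))%:E = (kappa * D)%:E * kappa%:E); last first.
  by rewrite -EFinM mulrC.
by rewrite -muleA lee_wpmul2l.
Qed.

(** Integrating [translates_le] over [K] replaces [g] by [h] on the right.  On the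
    left, where [t i] need not normalize [K], the integral becomes a Riemann sum
    over cells so small that their conjugates by every [t i] stay in [K]; the
    Harnack inequality absorbs the error. *)
Lemma discretized : exists n (r : nat -> G) (lam : nat -> R),
  [/\ forall j, (j < n)%N -> K (r j), forall j, (0 <= lam j)%R,
      (\sum_(j < n) lam j)%R = measK &
      forall s, \sum_(j < n) (b * delta * lam j)%:E * hsum ((r j)^-1 * s)%g <= E%:E * h s].
Proof.
have W1 : nbhs (1%g : G) [set v | forall i : 'I_N,
    K ((t i)^-1 * v * (t i)^-1^-1)%g /\ K (t i * v * (t i)^-1)%g].
  apply: filter_forall => i; apply: filterI; exact: nbhs1_conj.
have [n [r [Y [mY tY rK YW KY]]]] := compact_partition cK W1 hG.1.
have YK j : (j < n)%N -> Y j `<=` K.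
  by move=> jn t' Yt; rewrite KY -bigcup_mkord; exists j.
have Yfin j : (j < n)%N -> mu (Y j) = (fine (mu (Y j)))%:E.
  move=> jn; rewrite fineK// ge0_fin_numE//.
  by apply: le_lt_trans (haar_compact hmu cK); apply: haar_le => //; [exact: mY|exact: YK].
exists n, r, (fun j => fine (mu (Y j))); split => //.
- have KYE : mu K = \sum_(j < n) mu (Y j).
    by rewrite {1}KY; exact: (measure_bigsetU mu mY tY n).
  apply: EFin_inj; rewrite -measKE KYE -sumEFin.
  by apply: eq_bigr => j _; rewrite -Yfin.
move=> s.
have D0 := harnack_cst_gt0.
have E0 : (0 <= E)%R.
  have D0' := ltW D0; have k0' := ltW kappa0.
  by apply: mulr_ge0 => //; apply: mulr_ge0 => //; exact: mulr_ge0.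
apply: (@le_trans _ _ (\sum_(j < n) E%:E * setconv mu (Y j) g s)); last first.
  rewrite -ge0_sume_distrr; last by move=> j _; exact: setconv_ge0.
  by rewrite -(setconv_bigsetU n s mY tY) -KY.
apply: lee_sum => j _; have jn := ltn_ord j.
have -> : E%:E * setconv mu (Y j) g s = setconv mu (Y j) (fun x => E%:E * g x) s.
  rewrite /setconv (ge0_integralZl_EFin mu (mY j))//.
  by apply: measurable_funTS; exact: (borel_fun_invmulg s mg).
have h0 x : 0 <= hsum x.
  by apply: sume_ge0 => i _; rewrite adde_ge0 ?setconvK_ge0.
rewrite EFinM -Yfin// muleAC.
apply: setconv_cst_le.
- exact: mY.
- exact: measurable_funeM.
- by rewrite mule_ge0// lee_fin mulr_ge0.
move=> x Yx; apply: (@le_trans _ _ (D%:E * ((b * delta)%:E * hsum (x^-1 * s)%g))); last first.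
  rewrite (_ : E%:E = D%:E * (kappa * (kappa * D))%:E); last by rewrite -EFinM.
  by rewrite -muleA lee_wpmul2l ?lee_fin ?(ltW D0)// translates_le.
rewrite muleCA lee_wpmul2l ?lee_fin ?mulr_ge0//.
rewrite /hsum ge0_sume_distrr; last by move=> i _; rewrite adde_ge0 ?setconvK_ge0.
apply: lee_sum => i _; rewrite ge0_muleDr ?setconvK_ge0//.
have [W1x W2x] := YW j x Yx i.
apply: leeD.
  have -> : ((t i)^-1 * ((r j)^-1 * s) =
     ((t i)^-1 * ((r j)^-1 * x) * (t i)^-1^-1) * ((t i)^-1 * (x^-1 * s)))%g.
    by rewrite invgK -!mulgA !mulVKg.
  exact: harnack.
have -> : (t i * ((r j)^-1 * s) =
     (t i * ((r j)^-1 * x) * (t i)^-1) * (t i * (x^-1 * s)))%g.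
  by rewrite -!mulgA !mulKg !mulVKg.
exact: harnack.
Qed.

(** The set [tame] is a subgroup containing the neighbourhood [K] and all
    [t i]; on it [h] is positive and finite.  As [h] may vanish elsewhere, its
    values on [tame] are copied to every coset by a continuous retraction [pi]
    commuting with left translation by [tame], and the mean is applied to the
    increments of [ln \o h \o pi]. *)
Lemma translates_bound Z : amenable mu -> borel Z -> mu Z = 0 ->
  (forall x, ~ Z x -> g x < +oo) -> (forall x, V x -> 1 <= g x) ->
  (0 < b)%R -> (0 < delta)%R ->
  ((2 * N)%:R * (b * delta * measK) <= E * D)%R.
Proof.
move=> am mZ Z0 gZ gV bpos dpos.
have D0 := harnack_cst_gt0.
have E0 : (0 <= E)%R.
  have D0' := ltW D0; have k0' := ltW kappa0.
  by apply: mulr_ge0 => //; apply: mulr_ge0 => //; exact: mulr_ge0.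
pose H x : R := fine (h x).
have HE x : h x = (H x)%:E.
  by rewrite fineK// ge0_fin_numE ?setconvK_ge0//; exact: setconvK_fin mZ Z0 gZ.
have H0 x : (0 <= H x)%R by rewrite fine_ge0// setconvK_ge0.
have harn v x : K v -> (H (v * x)%g <= D * H x)%R.
  by move=> Kv; rewrite -lee_fin EFinM -!HE; exact: harnack.
have [n [r [lam [rK lam0 slam dis]]]] := discretized.
pose Hsum x : R := (\sum_(i < N) (H ((t i)^-1 * x)%g + H (t i * x)%g))%R.
have hsumE x : hsum x = (Hsum x)%:E.
  by rewrite /hsum -sumEFin; apply: eq_bigr => i _; rewrite !HE.
have disR s : (\sum_(j < n) b * delta * lam j * Hsum ((r j)^-1 * s)%g <= E * H s)%R.
  rewrite -lee_fin EFinM -HE -sumEFin; apply: le_trans (dis s).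
  by rewrite le_eqVlt; apply/orP; left; apply/eqP; apply: eq_bigr => j _; rewrite hsumE.
have Hsum0 x : (0 <= Hsum x)%R by apply: sumr_ge0 => i _; exact: addr_ge0.
have [j lamj] : exists j : 'I_n, (0 < lam j)%R.
  apply: contrapT => nj; have := measK_gt0; rewrite -slam big1 ?ltxx// => j _.
  by apply/eqP; rewrite eq_le lam0 andbT leNgt; apply/negP => lj; apply: nj; exists j.
pose c0 : R := (E * D / (b * delta * lam j))%R.
have c00 : (0 <= c0)%R by apply: divr_ge0; [exact: mulr_ge0 E0 (ltW D0)|rewrite !mulr_ge0].
have bdl : (0 < b * delta * lam j)%R by rewrite !mulr_gt0.
have Hsum_le x : (Hsum x <= c0 * H x)%R.
  rewrite /c0 mulrAC ler_pdivlMr// mulrC.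
  apply: (@le_trans _ _ (E * H (r j * x)%g)%R).
    apply: le_trans (disR _); rewrite (bigD1 j)//= mulKg lerDl.
    by apply: sumr_ge0 => k _; rewrite !mulr_ge0.
  by rewrite -(mulrA E D) ler_wpM2l// harn//; exact: rK.
have tame_t i : (i < N)%N -> tame (t i).
  move=> iN; exists c0 => // s.
  have le2 : (H ((t i)^-1 * s)%g + H (t i * s)%g <= c0 * H s)%R.
    apply: le_trans (Hsum_le s); rewrite /Hsum (bigD1 (Ordinal iN))//= lerDl.
    by apply: sumr_ge0 => k _; exact: addr_ge0.
  rewrite !HE -EFinM !lee_fin; split; apply: le_trans le2; first by rewrite lerDr.
  by rewrite lerDl.
have tame1 : tame 1%g by exact: tame_K.
have h1 := setconvK_gt0 gV.
have tameH x : tame x -> (0 < H x)%R.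
  by move=> /(tame_gt0 h1); rewrite HE lte_fin.
pose rep s := xget 1%g [set x | tame (s * x^-1)%g].
pose pi s := (s * (rep s)^-1)%g.
have piT s : tame (pi s).
  by apply: (@xgetPex _ 1%g [set x | tame (s * x^-1)%g]); exists s; rewrite /= mulgV.
have piM y s : tame y -> pi (y * s)%g = (y * pi s)%g.
  move=> ty; rewrite /pi mulgA; congr (_ * _^-1)%g; congr xget.
  apply/seteqP; split => x /= tx.
    by rewrite -(mulKg y s) -mulgA; apply: tame_mul => //; exact: tame_inv.
  by rewrite -mulgA; exact: tame_mul.
have cpi : continuous pi.
  move=> s W sW.
  have nW : nbhs s [set y | W (y * (s^-1 * pi s))%g].
    by have := @continuous_rmulg G (s^-1 * pi s)%g s W; rewrite mulVKg => /(_ sW).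
  have nK : nbhs s [set y | K (y * s^-1)%g].
    by have := @continuous_rmulg G s^-1%g s K; rewrite mulgV => /(_ K1).
  apply: (@filterS _ (nbhs s) _ _ (pi @^-1` W) _ (filterI nW nK)) => y [/= Wy Ky].
  by rewrite /= -[y](mulgVK s) piM; [rewrite -mulgA|exact: tame_K].
pose l s : R := ln (H (pi s)).
have expl s : expR (l s) = H (pi s) by rewrite /l lnK// posrE tameH.
have ml : borel_rfun l.
  apply: (measurableT_comp (@measurable_ln R)).
  apply: (measurableT_comp (fine_measurable _)) => //.
  apply: (borel_fun_comp cpi); apply: borel_fun_setconv => //.
  exact: haar_compact hmu _ cK.
have lle x y (c : R) : (0 < c)%R -> tame x -> tame y -> (H x <= c * H y)%R ->
    (ln (H x) <= ln c + ln (H y))%R.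
  move=> c1 tx ty xy; rewrite -lnM ?posrE ?tameH//.
  by rewrite ler_ln ?posrE ?mulr_gt0 ?tameH.
have tb i : (i < N)%N -> exists c : R, forall s, (`|l (t i * s)%g - l s| <= c)%R.
  move=> iN; have tti := tame_t i iN; have [c cpos ct] := tti.
  exists (ln (c + 1)) => s; rewrite /l piM//.
  have cc x y : h x <= c%:E * h y -> (H x <= (c + 1) * H y)%R.
    rewrite !HE -EFinM lee_fin => /le_trans; apply.
    by rewrite ler_wpM2r// lerDl.
  have c1 : (0 < c + 1)%R by rewrite ltr_wpDl.
  have e1 := lle _ _ _ c1 (tame_mul tti (piT s)) (piT s) (cc _ _ (ct (pi s)).1).
  have := (ct (t i * pi s)%g).2; rewrite mulKg => /cc.
  move=> /(lle _ _ _ c1 (piT s) (tame_mul tti (piT s))) e2.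
  by rewrite ler_norml; apply/andP; split; lra.
have rd j' s : (j' < n)%N -> (l s - ln D <= l ((r j')^-1 * s)%g)%R.
  move=> jn; have tr := tame_inv (tame_K (rK j' jn)).
  rewrite /l piM// lerBlDl; apply: lle => //; first exact: tame_mul.
  by rewrite -{1}[pi s](mulVKg (r j')); exact: harn (rK j' jn).
have lam0' k : (0 <= b * delta * lam k)%R by rewrite !mulr_ge0.
clearbody l.
have key s : (\sum_(k < n) b * delta * lam k * \sum_(i < N)
     (expR (l ((t i)^-1 * ((r k)^-1 * s))%g) + expR (l (t i * ((r k)^-1 * s))%g)) <=
     E * expR (l s))%R.
  rewrite [expR (l s)]expl; apply: le_trans (disR (pi s)).
  apply: ler_sum => k _; apply: ler_wpM2l; first exact: lam0'.
  apply: ler_sum => i _.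
  have tr := tame_inv (tame_K (rK k (ltn_ord k))).
  have tti := tame_t i (ltn_ord i).
  by rewrite !expl !piM//; exact: tame_inv.
have := @log_mean_bound _ _ mu l n N (fun k => (r k)^-1)%g t
  (fun k => b * delta * lam k)%R (ln D) E am ml tb rd lam0' key.
by rewrite -mulr_sumr slam lnK// posrE.
Qed.

End Translates.

End Harnack.

(** * Infinite packings do not exist *)

(** With blocks of [M ^ m] terms equal to [beta ^ m], the sums of the [p]-th
    powers decay geometrically while the plain sums are unbounded. *)
Lemma exponential_blocks (R : realType) (p : R) : 1 < p ->
  exists M : nat, exists beta : R,
    [/\ 0 < beta, M%:R * beta `^ p = 2^-1 & 2 <= M%:R * beta].
Proof.
move=> p1; have p0 : 0 < p by exact: lt_trans p1.
pose q := 1 - p^-1; have q0 : 0 < q by rewrite subr_gt0 invf_lt1.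
pose M := (Num.truncn (4 `^ q^-1 : R)).+1.
have M0 : 0 < M%:R :> R by rewrite ltr0n.
have Mq : 4 <= M%:R `^ q :> R.
  rewrite (_ : 4 = (4 `^ q^-1) `^ q); last by rewrite -powRrM mulVf ?gt_eqF// powRr1.
  apply: ge0_ler_powR; rewrite ?nnegrE ?powR_ge0 ?(ltW q0)//.
  by apply: ltW; exact: truncnS_gt.
exists M, ((2 * M%:R)^-1 `^ p^-1); split.
- by rewrite powR_gt0// invr_gt0 mulr_gt0.
- rewrite -powRrM mulVf ?gt_eqF// powRr1 ?invr_ge0 ?mulr_ge0//.
  by rewrite invfM mulrCA mulfV ?mulr1// gt_eqF.
rewrite invfM powRM ?invr_ge0//.
have -> : (M%:R^-1 : R) `^ p^-1 = M%:R `^ (- p^-1).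
  by rewrite -powR_inv1// -powRrM mulN1r.
rewrite mulrCA -{1}[M%:R]powRr1// -powRD; last by rewrite gt_eqF ?implybT.
have h2 : 2^-1 <= (2^-1 : R) `^ p^-1.
  rewrite -{1}[2^-1 : R]powRr1//; apply: ger_powR => //; first by apply/andP; split; lra.
  by rewrite ltW// invf_lt1.
apply: (@le_trans _ _ (2^-1 * 4)); first by lra.
exact: ler_pM.
Qed.

Lemma avoiding_sequence (T : eqType) (P : T -> Prop) (Q : T -> T -> Prop) :
  (forall l : seq T, exists2 x, P x & forall y, y \in l -> Q y x) ->
  exists t : nat -> T, (forall i, P (t i)) /\ forall i j, (i < j)%N -> Q (t i) (t j).
Proof.
move=> H; have H' (l : seq T) : exists x, P x /\ forall y, y \in l -> Q y x.
  by have [x] := H l; exists x.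
have [f fP] := choice H'.
pose l := fix l k := if k is k'.+1 then f (l k') :: l k' else [::].
exists (fun k => f (l k)); split=> [i|i j ij]; first exact: (fP _).1.
apply: (fP _).2; elim: j ij => // j IH; rewrite ltnS leq_eqVlt inE.
by move=> /orP[/eqP ->|/IH ->]; rewrite ?eqxx ?orbT.
Qed.

Section Packing.
Context {R : realType} {G : topologicalGroupType}.
Context {mu : {measure set (borelType G) -> \bar R}}.
Hypotheses (hG : locally_compact_group G) (hmu : left_haar mu) (hA : amenable mu).
Context {w : G -> R} {p : R}.
Hypotheses (hw : weight w) (p1 : 1 < p) (alg : Lpw_algebra mu p w).

Local Notation lpw_norm := (lpw_norm (mu := mu) (w := w) (p := p)).
Local Notation Lpos := (Lpos (mu := mu) (w := w) (p := p)).
Local Notation bounded_Lpos := (bounded_Lpos (mu := mu) (w := w) (p := p)).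

(** A single function above all blocks, so that one constant bounds the
    convolutions by all of them. *)
Lemma blocks_dominated (A : nat -> set G) (L c : R) (M : nat) (beta : R) :
  (forall i, borel (A i)) -> trivIset [set: nat] A -> 0 <= L -> 0 <= c ->
  (forall i x, A i x -> w x <= L) -> (forall i, (mu (A i) <= c%:E)%E) ->
  0 < beta -> M%:R * beta `^ p = 2^-1 ->
  exists2 f, Lpos f & forall m, \forall x \ae mu,
    (\big[setU/set0]_(i < (M ^ m)%N) A i) x -> beta ^+ m <= f x.
Proof.
move=> mA tA L0 c0 AL Ac b0 Mb.
pose U m := \big[setU/set0]_(i < (M ^ m)%N) A i.
have mU m : borel (U m) by apply: bigsetU_measurable => i _; exact: mA.
have UL m x : U m x -> w x <= L.
  by rewrite /U -bigcup_mkord => -[i _]; exact: AL.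
have muU m : (mu (U m) <= ((M ^ m)%:R * c)%:E)%E.
  rewrite /U (measure_bigsetU mu mA tA).
  apply: (@le_trans _ _ (\sum_(i < (M ^ m)%N) c%:E)%E).
    by apply: lee_sum => i _; exact: Ac.
  by rewrite sumEFin lee_fin sumr_const card_ord mulr_natl.
pose F m x := beta ^+ m * \1_(U m) x.
have bm0 m : 0 <= beta ^+ m by rewrite exprn_ge0// ltW.
have mF m : borel_rfun (F m).
  apply: (measurable_funM (f := fun=> beta ^+ m)) => //.
  exact: (borel_rfun_indic (mU m)).
have F0 m x : 0 <= F m x by rewrite mulr_ge0.
have nF m : (lpw_norm (F m) <= ((2 * (L `^ p * c)) / (2 ^ m.+1)%:R)%:E)%E.
  have -> : lpw_norm (F m) = (((beta ^+ m) `^ p)%:E * lpw_norm \1_(U m))%E.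
    by apply: lpw_normZ => //; exact: (borel_rfun_indic (mU m)).
  apply: (@le_trans _ _ (((beta ^+ m) `^ p)%:E * ((L `^ p)%:E * ((M ^ m)%:R * c)%:E))%E).
    rewrite lee_wpmul2l ?lee_fin ?powR_ge0//.
    apply: le_trans (lpw_norm_indic_le hw p1 (mU m) L0 (UL m)) _.
    by rewrite lee_wpmul2l// lee_fin powR_ge0.
  rewrite -!EFinM lee_fin le_eqVlt; apply/orP; left; apply/eqP.
  have -> : (beta ^+ m) `^ p = (beta `^ p) ^+ m.
    by rewrite -powR_mulrn ?(ltW b0)// -powRrM mulrC powRrM powR_mulrn// powR_ge0.
  have e : (M%:R * beta `^ p) ^+ m = (2 ^+ m)^-1 by rewrite Mb exprVn.
  rewrite !natrX exprS; rewrite exprMn in e.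
  transitivity ((M%:R ^+ m * (beta `^ p) ^+ m) * (L `^ p * c)); first by ring.
  by rewrite e; field; rewrite expf_neq0.
have [] := summable_dominated (mu := mu) hw p1 (F := F) mF F0.
  apply: (@le_lt_trans _ _ (2 * (L `^ p * c))%:E); last exact: ltry.
  have J0 : 0 <= 2 * (L `^ p * c) by rewrite !mulr_ge0// powR_ge0.
  apply: le_trans (@epsilon_trick0 R _ xpredT J0).
  by apply: lee_nneseries => n *; [exact: lpw_norm_ge0|exact: nF].
move=> f [Z [Lf mZ Z0 FZ]]; exists f => // m.
apply: (haar_ae_outside mZ Z0) => x nZ Ux; have := FZ m x nZ.
by rewrite /F indicE mem_set// mulr1.
Qed.

(** The superharmonic functions of the successive blocks satisfy the bound of
    [translates_bound] with the same right-hand side, while the left-hand side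
    grows like [(M * beta) ^ m]. *)
Lemma no_infinite_packing (K V : set G) (t : nat -> G) (A B : nat -> set G) (L delta : R) :
  compact K -> nbhs (1%g : G) K -> (forall x, K x -> K x^-1%g) ->
  (forall x y z, K x -> K y -> K z -> V (x * y * z)%g) ->
  borel V -> (mu V < +oo)%E -> Lpos \1_V -> 0 <= L -> 0 < delta ->
  (forall i, borel (A i)) -> (forall i, borel (B i)) ->
  trivIset [set: nat] A -> trivIset [set: nat] B ->
  (forall i, A i `<=` ltrans (t i) K) -> (forall i, B i `<=` ltrans (t i)^-1%g K) ->
  (forall i x, A i x -> w x <= L) -> (forall i x, B i x -> w x <= L) ->
  (forall i, (delta%:E <= mu (A i))%E) -> (forall i, (delta%:E <= mu (B i))%E) -> False.
Proof.
move=> cK K1 Kinv KV mV Voo LV L0 d0 mA mB tA tB At Bt AL BL dA dB.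
have [M [beta [b0 Mb Mb2]]] := exponential_blocks p1.
have mK := compact_borel hG.1 cK.
have KE := measKE hmu cK; have k0 := measK_gt0 hG hmu cK K1.
have Ak i : (mu (A i) <= (measK (mu := mu) (K := K))%:E)%E.
  rewrite -KE -(haar_ltrans hmu (t i) mK); apply: haar_le => //; exact: borel_ltrans.
have Bk i : (mu (B i) <= (measK (mu := mu) (K := K))%:E)%E.
  by rewrite -KE -(haar_ltrans hmu (t i)^-1%g mK); apply: haar_le => //; exact: borel_ltrans.
have [fA LfA fAP] := blocks_dominated mA tA L0 (ltW k0) AL Ak b0 Mb.
have [fB LfB fBP] := blocks_dominated mB tB L0 (ltW k0) BL Bk b0 Mb.
have [CA CA0 bA] := conv_bounded hG hmu hw p1 alg LfA.
have [CB CB0 bB] := conv_bounded hG hmu hw p1 alg LfB.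
have [CV CV0 bV] := conv_bounded hG hmu hw p1 alg LV.
pose C := 2 `^ p * (2 `^ p * (CA + CB) + CV) + 1.
have P2 : 0 <= 2 `^ p :> R by exact: powR_ge0.
have C0 : 0 < C by rewrite ltr_wpDl// mulr_ge0// addr_ge0// mulr_ge0// addr_ge0.
have [kappa kap0 kapP] := superharmonic_exists (mu := mu) hw p1 C0.
have fin_union (Y : nat -> set G) n : (forall i, borel (Y i)) -> trivIset [set: nat] Y ->
    (forall i, (mu (Y i) <= (measK (mu := mu) (K := K))%:E)%E) ->
    borel (\big[setU/set0]_(i < n) Y i) /\ (mu (\big[setU/set0]_(i < n) Y i) < +oo)%E.
  move=> mY tY Yk; split; first by apply: bigsetU_measurable => i _; exact: mY.
  rewrite (measure_bigsetU mu mY tY); apply: lte_sum_pinfty => i _.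
  by apply: le_lt_trans (Yk i) _; rewrite ltry.
pose D := harnack_cst (mu := mu) (K := K) (kappa := kappa).
pose bound := D * (kappa * (kappa * D)) * D.
have each m : 2 ^+ m * (2 * (delta * measK (mu := mu) (K := K))) <= bound.
  pose N := (M ^ m)%N; pose b := beta ^+ m.
  have bpos : 0 < b by rewrite exprn_gt0.
  have [mUA UAoo] := fin_union A N mA tA Ak.
  have [mUB UBoo] := fin_union B N mB tB Bk.
  have [] := kapP b (\big[setU/set0]_(i < N) A i) (\big[setU/set0]_(i < N) B i) V \1_V
     (ltW bpos) mUA mUB mV UAoo UBoo Voo.
  - move=> g bg.
    have [gA nA] := rsetconv_bounded hG hmu hw p1 alg LfA bA CA0 (ltW bpos) mUA UAoo (fAP m) bg.
    have [gB nB] := rsetconv_bounded hG hmu hw p1 alg LfB bB CB0 (ltW bpos) mUB UBoo (fBP m) bg.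
    have V1 : \forall x \ae mu, V x -> 1 <= (\1_V : G -> R) x.
      by apply: aeW => x Vx; rewrite indicE mem_set.
    have [gV nV] := rsetconv_bounded hG hmu hw p1 alg LV bV CV0 ler01 mV Voo V1 bg.
    have [gAB nAB] := bounded_LposD hw p1 gA gB.
    have [gABV nABV] := bounded_LposD hw p1 gAB gV.
    split; first exact: gABV.
    apply: le_trans nABV _.
    have gE : lpw_norm g = (fine (lpw_norm g))%:E.
      by rewrite fineK// ge0_fin_numE ?lpw_norm_ge0//; have [[]] := bg.
    have J0 : 0 <= fine (lpw_norm g) by rewrite fine_ge0// lpw_norm_ge0.
    apply: (@le_trans _ _ ((2 `^ p)%:E * ((2 `^ p)%:E * (CA%:E * lpw_norm g + CB%:E * lpw_norm g) + CV%:E * lpw_norm g))%E).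
      rewrite lee_wpmul2l ?lee_fin// leeD//; apply: le_trans nAB _.
      by rewrite lee_wpmul2l ?lee_fin// leeD.
    rewrite gE -!EFinM lee_fin /C /=.
    by rewrite -mulrDl mulrA -mulrDl mulrA mulrDl mul1r lerDl.
  - by split => //; exists 1 => x; rewrite indicE lern1 leq_b1.
  move=> g [mg g0 [Z [mZ Z0 gZ]] gV cg].
  have h0 S s : (0 <= setconv mu S g s)%E by exact: setconv_ge0.
  have bh0 S s : (0 <= b%:E * setconv mu S g s)%E by rewrite mule_ge0// lee_fin ltW.
  have Vg s : (setconv mu V g s <= kappa%:E * g s)%E.
    by apply: le_trans (cg s); rewrite /conv3 leeDr// adde_ge0.
  have ABg s : (b%:E * setconv mu (\big[setU/set0]_(i < N) A i) g s +
     b%:E * setconv mu (\big[setU/set0]_(i < N) B i) g s <= kappa%:E * g s)%E.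
    by apply: le_trans (cg s); rewrite /conv3 leeDl.
  have gV1 x : V x -> (1 <= g x)%E.
    by move=> Vx; apply: le_trans (gV x); rewrite indicE mem_set.
  have := translates_bound hG hmu cK K1 Kinv KV mV mg g0 kap0 Vg (ltW bpos) (ltW d0)
    mA mB tA tB At Bt dA dB ABg hA mZ Z0 gZ gV1 bpos d0.
  apply: le_trans.
  rewrite natrM natrX.
  have e : 2 ^+ m <= M%:R ^+ m * beta ^+ m :> R.
    by rewrite -exprMn lerXn2r// nnegrE// (le_trans _ Mb2).
  have dk : 0 <= 2 * (delta * measK (mu := mu) (K := K)) by rewrite !mulr_ge0// ltW.
  apply: le_trans (ler_wpM2r dk e) _.
  by rewrite /b le_eqVlt; apply/orP; left; apply/eqP; ring.
have dk0 : 0 < 2 * (delta * measK (mu := mu) (K := K)) by rewrite !mulr_gt0.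
pose n := (Num.truncn (bound / (2 * (delta * measK (mu := mu) (K := K))))).+1.
have := each n; rewrite -ler_pdivlMr//; apply/negP; rewrite -ltNge.
apply: lt_le_trans (truncnS_gt _) _; rewrite -natrX ler_nat.
exact: ltnW (ltn_expl _ _).
Qed.

End Packing.

(** * Sigma-compactness *)

(** The set [E n] consists of the [x] such that [w <= n] on at least half of [x K]
    and of [x^-1 K].  In a sequence of elements of [E n], each outside the sets
    [y K K] and [K K y] of its predecessors [y], the translates [x K] are
    disjoint, and so are the [x^-1 K].  By [no_infinite_packing] it must stop, so
    that finitely many of these compact sets cover [E n]. *)
Theorem corollary3p3 (R : realType) (G : topologicalGroupType)
    (mu : {measure set (borelType G) -> \bar R})
    (hG : locally_compact_group G) (hmu : left_haar mu) (hA : amenable mu)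
    (hw : exists (w : G -> R) (p : R),
        weight w /\ 1 < p /\ Lpw_algebra mu p w) :
  sigma_compact G.
Proof.
have [w [p [ww [p1 alg]]]] := hw.
have [V [oV V1 Voo LV]] := finite_norm_nbhs1 hG hmu ww p1 alg.
have nV : nbhs (1%g : G) V by exact: open_nbhs_nbhs.
have [K [cK K1 Kinv KV]] := compact_symmetric_nbhs1 hG nV.
have mK := compact_borel hG.1 cK.
have KE := measKE hmu cK; have k0 := measK_gt0 hG hmu cK K1.
pose delta := measK (mu := mu) (K := K) / 2.
have d0 : 0 < delta by rewrite divr_gt0.
have dK : (delta%:E < mu K)%E by rewrite KE lte_fin /delta; lra.
pose KK := prodset K K.
have cKK : compact KK by exact: compact_prodset.
have KKinv x : KK x -> KK x^-1%g.
  by move=> [[a c] /= [Ka Kc] <-]; rewrite invgM; apply: mem_prodset; exact: Kinv.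
pose A (n : nat) x := ltrans x K `&` [set r | w r <= n%:R].
have mA n x : borel (A n x) by apply: borelI; [exact: borel_ltrans|exact: borel_sublevel].
pose E (n : nat) : set G := [set x | (delta%:E <= mu (A n x))%E /\ (delta%:E <= mu (A n x^-1%g))%E].
have EG x : exists n, E n x.
  have [n1 n1P] := sublevel_translates hG hmu ww cK dK x.
  have [n2 n2P] := sublevel_translates hG hmu ww cK dK x^-1%g.
  by exists (maxn n1 n2); split; [apply: n1P; exact: leq_maxl|apply: n2P; exact: leq_maxr].
have cover n : exists l : seq G, forall x, E n x ->
    exists2 y, y \in l & KK (y^-1 * x)%g \/ KK (x * y^-1)%g.
  apply: contrapT => nl.
  have [|t [Et tt]] := @avoiding_sequence G (E n)
      (fun y x => ~ KK (y^-1 * x)%g /\ ~ KK (x * y^-1)%g).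
    move=> l; apply: contrapT => nx; apply: nl; exists l => x Ex.
    apply: contrapT => ny; apply: nx; exists x => // y yl.
    by split => KKxy; apply: ny; exists y => //; [left|right].
  have triv (s : nat -> G) : (forall i j, (i < j)%N -> ~ KK ((s i)^-1 * s j)%g) ->
      trivIset [set: nat] (fun i => A n (s i)).
    move=> sP; have lt_absurd i j : (i < j)%N -> forall x, A n (s i) x -> A n (s j) x -> False.
      move=> ij x [Ki _] [Kj _]; apply: (sP i j ij).
      have -> : ((s i)^-1 * s j = ((s i)^-1 * x) * ((s j)^-1 * x)^-1)%g.
        by rewrite invgM invgK -!mulgA mulVKg.
      by apply: mem_prodset => //; exact: Kinv.
    move=> i j _ _ [x [Ai Aj]]; case: (ltngtP i j) => // ij; exfalso.
      exact: lt_absurd ij x Ai Aj.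
    exact: lt_absurd ij x Aj Ai.
  apply: (no_infinite_packing hG hmu hA ww p1 alg (t := t) (A := fun i => A n (t i))
    (B := fun i => A n (t i)^-1%g) (L := n%:R) (delta := delta) cK K1 Kinv KV) => //.
  - exact: open_borel.
  - by apply: triv => i j ij; exact: (tt i j ij).1.
  - by apply: triv => i j ij; rewrite invgK => /KKinv; rewrite invgM invgK; exact: (tt i j ij).2.
  - by move=> i x [].
  - by move=> i x [].
  - by move=> i x [].
  - by move=> i x [].
  - by move=> i; exact: (Et i).1.
  - by move=> i; exact: (Et i).2.
have [l lP] := choice cover.
pose C y : set G := ltrans y KK `|` prodset KK [set y].
exists (fun n => \big[setU/set0]_(y <- l n) C y).
  move=> n; apply: bigsetU_compact => y _; apply: compactU; first exact: compact_ltrans.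
  by apply: compact_prodset => //; exact: compact_set1.
apply/seteqP; split => // x _; have [n Ex] := EG x; exists n => //.
have [y yl xy] := lP n x Ex.
rewrite -bigcup_seq; exists y => //.
case: xy => [?|xy]; [by left|right].
by rewrite -[x](mulgVK y); apply: mem_prodset.
Qed.
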